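(* Let $A,H$ be bialgebras or Hopf algebras forming a double cross coproduct $H\blacktriangleright\!\!\blacktriangleleft A$ with coactions $\alpha:A\to A\otimes H$, $\beta:H\to A\otimes H$, and let $\Omega(A),\Omega(H)$ be strongly bicovariant exterior algebras such that $\alpha,\beta$ are differentiable with extensions $\alpha_*:\Omega(A)\to\Omega(A)\underline\otimes\Omega(H)$ and $\beta_*:\Omega(H)\to\Omega(A)\underline\otimes\Omega(H)$ satisfying $$(\Delta_{A*}\otimes\mathrm{id})\alpha_*(\omega)=\big((\mathrm{id}\otimes\beta_* )\alpha_*(\omega_{(1)})\big)\big(1_A\otimes\alpha_*(\omega_{(2)})\big),$$ $$(\mathrm{id}\otimes\Delta_{H*})\beta_*(\eta)=\big(\beta_*(\eta_{(1)})\otimes1_H\big)\big((\alpha_*\otimes\mathrm{id})\beta_*(\eta_{(2)})\big),$$ $$\alpha_*(\omega)\beta_*(\eta)=(-1)^{|\omega||\eta|}\beta_*(\eta)\alpha_*(\omega)$$ for all $\omega\in\Omega(A)$, $\eta\in\Omega(H)$. Then $\Omega(H\blacktriangleright\!\!\blacktriangleleft A):=\Omega(H)\blacktriangleright\!\!\blacktriangleleft\Omega(A)$ (the super double cross coproduct) is a strongly bicovariant exterior algebra on $H\blacktriangleright\!\!\blacktriangleleft A$ with differential $$d(\eta\otimes\omega)=d_H\eta\otimes\omega+(-1)^{|\eta|}\eta\otimes d_A\omega.$$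
   Context: Work over a field $k$. An exterior algebra on an algebra $A$ is a differential graded algebra $\Omega(A)=\oplus_{n\ge0}\Omega^n(A)$ with $\Omega^0=A$, generated by $A$ and $\Omega^1=\mathrm{span}\{a\,db\}$, with $d^2=0$ and graded Leibniz rule. The super tensor product $\underline\otimes$ has product $(a\otimes b)(c\otimes d)=(-1)^{|b||c|}ac\otimes bd$ and, for DGAs, differential $d\otimes\mathrm{id}+(-1)^{|\ |}\mathrm{id}\otimes d$, where $(-1)^{|\ |}\omega=(-1)^{|\omega|}\omega$. For $A$ a bialgebra (resp. Hopf algebra), $\Omega(A)$ is strongly bicovariant if it is a super-bialgebra (resp. super-Hopf algebra) with super grade the form degree mod 2, with coproduct $\Delta_*$ preserving total degree, restricting to $\Delta$ on $A$, and $\Delta_*d\omega=(d\otimes\mathrm{id}+(-1)^{|\ |}\mathrm{id}\otimes d)\Delta_*\omega$. Sweedler notation $\Delta_*\omega=\omega_{(1)}\otimes\omega_{(2)}$ is with homogeneous components; products in multiple tensor products are in the super tensor product algebra. A double cross coproduct $H\blacktriangleright\!\!\blacktriangleleft A$: $A$ is a right $H$-comodule algebra by $\alpha:A\to A\otimes H$, $H$ is a left $A$-comodule algebra by $\beta:H\to A\otimes H$, compatible (the three displayed conditions of the claim restricted to degree 0) so that $H\otimes A$ with tensor product algebra, tensor product counit and coproduct $\Delta(h\otimes a)=h_{(1)}\otimes\alpha(a_{(1)})\beta(h_{(2)})\otimes a_{(2)}$ is a bialgebra or Hopf algebra. Differentiability of $\alpha,\beta$ means they extend to total-degree-preserving maps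 $\alpha_*,\beta_*$ as in the claim that are super comodule algebra structures ($\Omega(A)$ a super right $\Omega(H)$-comodule algebra, $\Omega(H)$ a super left $\Omega(A)$-comodule algebra) and commute with the differentials, the one on $\Omega(A)\underline\otimes\Omega(H)$ being $d_A\otimes\mathrm{id}+(-1)^{|\ |}\mathrm{id}\otimes d_H$. The super double cross coproduct $\Omega(H)\blacktriangleright\!\!\blacktriangleleft\Omega(A)$ is $\Omega(H)\underline\otimes\Omega(A)$ with super tensor product algebra and counit, and $$\Delta_*(\eta\otimes\omega)=(-1)^{|\omega_{(1)}||\eta_{(2)}|}\eta_{(1)}\otimes\alpha_*(\omega_{(1)})\beta_*(\eta_{(2)})\otimes\omega_{(2)}.$$ *)

(* Defs.v *)
From HB Require Import structures.
From mathcomp Require Import all_boot all_order all_algebra.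
From mathcomp Require Import boolp classical_sets.

Set Implicit Arguments.
Unset Strict Implicit.
Unset Printing Implicit Defensive.

Import GRing.Theory.
Local Open Scope ring_scope.
Local Open Scope quotient_scope.

Reserved Notation "V ⊗ W" (at level 40, left associativity).
Reserved Notation "v ⊗t w" (at level 40, left associativity).
Reserved Notation "A ⊗s B" (at level 40, left associativity).

Notation bilinear_map f := (bilinear_for *:%R *:%R f).

Section Tensor.
Variables (k : fieldType) (V W : lmodType k).
Implicit Types (s t : seq (V * W)).

(* A formal sum of pairs is a list; two formal sums represent the same tensor
   iff they are related by the congruence generated by commutativity of the sum
   and bilinearity of the pairs. *)
Inductive tens_eq : seq (V * W) -> seq (V * W) -> Prop :=
| TensRefl s : tens_eq s s
| TensSym s t : tens_eq s t -> tens_eq t s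
| TensTrans s t u : tens_eq s t -> tens_eq t u -> tens_eq s u
| TensCat s s' t t' :
    tens_eq s s' -> tens_eq t t' -> tens_eq (s ++ t) (s' ++ t')
| TensC s t : tens_eq (s ++ t) (t ++ s)
| TensDl v v' w : tens_eq [:: (v + v', w)] [:: (v, w); (v', w)]
| TensDr v w w' : tens_eq [:: (v, w + w')] [:: (v, w); (v, w')]
| TensZ c v w : tens_eq [:: (c *: v, w)] [:: (v, c *: w)]
| Tens0 w : tens_eq [:: (0, w)] [::].

Definition tens_rel : rel (seq (V * W)) := fun s t => `[< tens_eq s t >].

Lemma tens_rel_refl : reflexive tens_rel.
Proof. by move=> s; apply/asboolP/TensRefl. Qed.

Lemma tens_rel_sym : symmetric tens_rel.
Proof. by move=> s t; apply/idP/idP => /asboolP h; apply/asboolP/TensSym. Qed.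

Lemma tens_rel_trans : transitive tens_rel.
Proof.
by move=> t s u /asboolP h /asboolP h'; apply/asboolP/(TensTrans h h').
Qed.

Canonical tens_equiv := EquivRel tens_rel tens_rel_refl tens_rel_sym tens_rel_trans.

Definition tensor : Type := {eq_quot tens_rel}.

HB.instance Definition _ := Choice.on tensor.
HB.instance Definition _ := EqQuotient.on tensor.

Local Notation cls s := (\pi_tensor s).

Lemma tens_clsP s t : reflect (tens_eq s t) (cls s == cls t).
Proof. by rewrite eqmodE; apply: asboolP. Qed.

Lemma tens_cls_eq s t : tens_eq s t -> cls s = cls t.
Proof. by move=> /tens_clsP/eqP. Qed.

Lemma tens_repr s : tens_eq (repr (cls s)) s.
Proof. by apply/tens_clsP; rewrite reprK. Qed.

Definition tens_add (x y : tensor) : tensor := cls (repr x ++ repr y).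
Definition tens_scale (c : k) (x : tensor) : tensor :=
  cls [seq (c *: p.1, p.2) | p <- repr x].
Definition tens_opp (x : tensor) : tensor := cls [seq (- p.1, p.2) | p <- repr x].

Lemma tens_addE s t : tens_add (cls s) (cls t) = cls (s ++ t).
Proof. by apply: tens_cls_eq; apply: TensCat; apply: tens_repr. Qed.

Lemma tens_eq_scale c s t : tens_eq s t ->
  tens_eq [seq (c *: p.1, p.2) | p <- s] [seq (c *: p.1, p.2) | p <- t].
Proof.
elim=> {s t} [s|s t _|s t u _ + _|s s' t t' _ + _|s t|v v' w|v w w'|a v w|w] /=.
- exact: TensRefl.
- exact: TensSym.
- exact: TensTrans.
- by rewrite !map_cat; apply: TensCat.
- by rewrite !map_cat; exact: TensC.
- by rewrite scalerDr; apply: TensDl.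
- exact: TensDr.
- by rewrite scalerA mulrC -scalerA; apply: TensZ.
- by rewrite scaler0; apply: Tens0.
Qed.

Lemma tens_scaleE c s : tens_scale c (cls s) = cls [seq (c *: p.1, p.2) | p <- s].
Proof. by apply: tens_cls_eq; apply: tens_eq_scale; apply: tens_repr. Qed.

Lemma tens_oppE x : tens_opp x = tens_scale (-1) x.
Proof.
by congr (cls _); apply: eq_map => p; rewrite scaleN1r.
Qed.

Lemma tens_cls_surj (x : tensor) : exists s, x = cls s.
Proof. by exists (repr x); rewrite reprK. Qed.

Lemma tens_addA : associative tens_add.
Proof.
move=> x y z; have [s ->] := tens_cls_surj x; have [t ->] := tens_cls_surj y.
have [u ->] := tens_cls_surj z.
rewrite (tens_addE t u) (tens_addE s t) (tens_addE s (t ++ u)).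
by rewrite (tens_addE (s ++ t) u) catA.
Qed.

Lemma tens_addC : commutative tens_add.
Proof. by move=> x y; apply: tens_cls_eq; apply: TensC. Qed.

Lemma tens_add0 : left_id (cls [::]) tens_add.
Proof. 
by move=> x; have [s ->] := tens_cls_surj x; rewrite (tens_addE [::] s).
Qed.

Lemma tens_scaleDl x : {morph tens_scale^~ x : a b / a + b >-> tens_add a b}.
Proof.
move=> a b /=; have [s0 ->] := tens_cls_surj x.
rewrite !tens_scaleE (tens_addE (map _ _) (map _ _)).
apply: tens_cls_eq; elim: s0 => [|[v w] s ih] /=; first exact: TensRefl.
set s0' := map _ s in ih *; set s1 := map _ s in ih *; set s2 := map _ s in ih *.
rewrite -cat1s; apply: TensTrans
  (_ : tens_eq ([:: (a *: v, w); (b *: v, w)] ++ (s1 ++ s2)) _).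
  by apply: TensCat ih; rewrite scalerDl; apply: TensDl.
have := TensCat (TensRefl [:: (a *: v, w)])
  (TensCat (TensC [:: (b *: v, w)] s1) (TensRefl s2)).
by rewrite -!catA.
Qed.

Lemma tens_scaleDr : right_distributive tens_scale tens_add.
Proof.
move=> a x y; have [s ->] := tens_cls_surj x; have [t ->] := tens_cls_surj y.
rewrite (tens_addE s t) !tens_scaleE (tens_addE (map _ _) (map _ _)).
by rewrite map_cat.
Qed.

Lemma tens_scaleA a b x : tens_scale a (tens_scale b x) = tens_scale (a * b) x.
Proof.
have [s ->] := tens_cls_surj x; rewrite !tens_scaleE -map_comp; congr (cls _).
by apply: eq_map => p /=; rewrite scalerA.
Qed.

Lemma tens_scale1 : left_id 1 tens_scale.
Proof.
move=> x; rewrite -[x in RHS]reprK; congr (cls _).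
by rewrite -[RHS]map_id; apply: eq_map => -[v w] /=; rewrite scale1r.
Qed.

Lemma tens_scale0 x : tens_scale 0 x = cls [::].
Proof.
have [s0 ->] := tens_cls_surj x; rewrite tens_scaleE; apply: tens_cls_eq.
elim: s0 => [|[v w] s ih] /=; first exact: TensRefl.
rewrite -cat1s -[[::] in X in tens_eq _ X]cats0; apply: TensCat ih.
by rewrite scale0r; apply: Tens0.
Qed.

Lemma tens_addN : left_inverse (cls [::]) tens_opp tens_add.
Proof.
move=> x; rewrite tens_oppE -{2}[x]tens_scale1 -tens_scaleDl addNr.
exact: tens_scale0.
Qed.

HB.instance Definition _ :=
  GRing.isZmodule.Build tensor tens_addA tens_addC tens_add0 tens_addN.
HB.instance Definition _ := GRing.Zmodule_isLmodule.Build k tensor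
  tens_scaleA tens_scale1 tens_scaleDr tens_scaleDl.

Lemma tens_clsD s t : cls s + cls t = cls (s ++ t).
Proof. exact: tens_addE. Qed.

Lemma tens_clsZ c s : c *: cls s = cls [seq (c *: p.1, p.2) | p <- s].
Proof. exact: tens_scaleE. Qed.

Definition tens (v : V) (w : W) : tensor := cls [:: (v, w)].

Lemma tens_bilinear : bilinear_map tens.
Proof.
split=> [w a v v'|v a w w'] /=; rewrite /tens tens_clsZ tens_clsD /=.
  by apply: tens_cls_eq; apply: TensDl.
apply: tens_cls_eq; apply: TensTrans (TensDr _ _ _) _.
apply: (TensCat (s := [:: _]) (s' := [:: _])) (TensRefl _).
by apply: TensSym; apply: TensZ.
Qed.

Lemma tens_sum (x : tensor) : x = \sum_(p <- repr x) tens p.1 p.2.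
Proof.
rewrite -[LHS]reprK; elim: (repr x) => [|[v w] s ih].
  by rewrite big_nil.
by rewrite big_cons -ih tens_clsD.
Qed.

Lemma tens_ind (P : tensor -> Prop) :
  P 0 -> (forall v w, P (tens v w)) -> (forall x y, P x -> P y -> P (x + y)) ->
  forall x, P x.
Proof.
move=> P0 Pt PD x; rewrite [x]tens_sum.
by elim/big_ind: _ => // p _; apply: Pt.
Qed.

End Tensor.

Arguments tens {k V W}.
Notation "V ⊗ W" := (tensor V W) : type_scope.
Notation "v ⊗t w" := (tens v w) : ring_scope.

Section Linear.
Variables (k : fieldType) (U V W : lmodType k).

Lemma lin0 (h : U -> V) : linear h -> h 0 = 0.
Proof. by move=> hL; have /= := scalable_linear hL 0 0; rewrite !scale0r. Qed.

Lemma linD (h : U -> V) : linear h -> {morph h : x y / x + y}.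
Proof. by move=> hL x y; have /= := hL 1 x y; rewrite !scale1r. Qed.

Lemma linZ (h : U -> V) : linear h -> forall a, {morph h : x / a *: x}.
Proof. by move=> hL; apply: scalable_linear. Qed.

Lemma lin_sum (h : U -> V) I (r : seq I) (P : pred I) (F : I -> U) : linear h ->
  h (\sum_(i <- r | P i) F i) = \sum_(i <- r | P i) h (F i).
Proof. by move=> hL; exact: (big_morph h (linD hL) (lin0 hL)). Qed.

Lemma lin_comp (g : V -> W) (h : U -> V) :
  linear g -> linear h -> linear (fun x => g (h x)).
Proof. by move=> gL hL a x y; rewrite hL gL. Qed.

Lemma lin_id : linear (fun x : U => x).
Proof. by []. Qed.

End Linear.

Section TensLinear.
Variables (k : fieldType) (V W : lmodType k).

Lemma tensPl a (v v' : V) (w : W) :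
  (a *: v + v') ⊗t w = a *: (v ⊗t w) + v' ⊗t w.
Proof. exact: (tens_bilinear V W).1. Qed.

Lemma tensPr a (v : V) (w w' : W) :
  v ⊗t (a *: w + w') = a *: (v ⊗t w) + v ⊗t w'.
Proof. exact: (tens_bilinear V W).2. Qed.

Lemma tens0l (w : W) : (0 : V) ⊗t w = 0.
Proof. exact: (lin0 (h := tens^~ w) ((tens_bilinear V W).1 w)). Qed.

Lemma tens0r (v : V) : v ⊗t (0 : W) = 0.
Proof. exact: (lin0 (h := tens v) ((tens_bilinear V W).2 v)). Qed.

End TensLinear.

Section Lift.
Variables (k : fieldType) (V W U : lmodType k).

(* Meaningful for bilinear f only: the linear map v ⊗ w |-> f v w. *)
Definition tlift (f : V -> W -> U) (x : V ⊗ W) : U :=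
  \sum_(p <- repr x) f p.1 p.2.

Lemma tlift_pi (f : V -> W -> U) (s : seq (V * W)) : bilinear_map f ->
  tlift f (\pi s) = \sum_(p <- s) f p.1 p.2.
Proof.
case=> fl fr; rewrite /tlift.
have fB w : linear (f^~ w) := fl w.
have fC v : linear (f v) := fr v.
suff sumE s1 s2 : tens_eq s1 s2 ->
    \sum_(p <- s1) f p.1 p.2 = \sum_(p <- s2) f p.1 p.2.
  exact: sumE (tens_repr s).
elim=> {s s1 s2} [s|s t _ ->|s t u _ -> _|s s' t t' _ h _ h'|s t|v v' w|v w w'|a v w|w] //.
- by rewrite !big_cat h h'.
- by rewrite !big_cat /= addrC.
- by rewrite !big_cons big_nil !addr0 (linD (fB w)).
- by rewrite !big_cons big_nil !addr0 (linD (fC v)).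
- rewrite !big_cons big_nil !addr0 /=.
  by rewrite (linZ (fB w)) (linZ (fC v)).
- by rewrite big_cons big_nil addr0 (lin0 (fB w)).
Qed.

Lemma tliftE (f : V -> W -> U) v w : bilinear_map f -> tlift f (v ⊗t w) = f v w.
Proof. by move=> fB; rewrite tlift_pi // big_cons big_nil addr0. Qed.

Lemma tlift_linear (f : V -> W -> U) : bilinear_map f -> linear (tlift f).
Proof.
move=> fB a x y; have [s ->] := tens_cls_surj x; have [t ->] := tens_cls_surj y.
rewrite tens_clsZ tens_clsD !tlift_pi //.
rewrite big_cat big_map scaler_sumr; congr (_ + _).
by apply: eq_bigr => p _ /=; rewrite (linZ (fB.1 p.2)).
Qed.

Lemma eq_tlift (f g : V -> W -> U) x : f =2 g -> tlift f x = tlift g x.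
Proof. by move=> fg; apply: eq_bigr => p _. Qed.

Lemma tlift_fun_linear a (f g : V -> W -> U) x :
  tlift (fun v w => a *: f v w + g v w) x = a *: tlift f x + tlift g x.
Proof. by rewrite /tlift big_split scaler_sumr. Qed.

End Lift.


Lemma linear_tens_eq (k : fieldType) (V W U : lmodType k) (f g : V ⊗ W -> U) :
  linear f -> linear g -> (forall v w, f (v ⊗t w) = g (v ⊗t w)) -> f =1 g.
Proof.
move=> fL gL fg; apply: tens_ind => [|v w|x y hx hy].
- by rewrite !lin0.
- exact: fg.
- by rewrite !linD // hx hy.
Qed.

Section TensorNontrivial.
Variable k : fieldType.

Lemma exists_functional (V : lmodType k) (v : V) :
  v != 0 -> exists2 f : V -> k^o, linear f & f v = 1.
Proof.
move=> v0.
pose P : set (set V) :=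
  [set S | (forall a x y, S x -> S y -> S (a *: x + y)) /\ ~ S v]%classic.
have [F FP Ftot|A [[AL Av] Amax]] := @Zorn_bigcup V P.
  split=> [a x y [S FS Sx] [T FT Ty]|[S FS Sv]]; last exact: (FP _ FS).2.
  have [/(_ x Sx) Tx|/(_ y Ty) Sy] := Ftot _ _ FS FT.
    by exists T => //; apply: (FP _ FT).1.
  by exists S => //; apply: (FP _ FS).1.
have A0 : A 0.
  apply: contrapT => nA0; apply: (Amax [set 0]%classic); last first.
    split; first by move=> a x y /= -> ->; rewrite scaler0 addr0.
    by move=> /= /eqP; apply/negP.
  split; last by move=> /(_ 0 erefl).
  move=> x Ax; exfalso; apply: nA0.
  by have := AL (-1) _ _ Ax Ax; rewrite scaleN1r addNr.
have AZ a x : A x -> A (a *: x) by move=> Ax; rewrite -[_ *: _]addr0; apply: AL.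
have ex x : exists c, A (x - c *: v).
  have [Ax|nAx] := pselect (A x); first by exists 0; rewrite scale0r subr0.
  pose B : set V := [set y | exists c, A (y - c *: x)]%classic.
  have AB : (A `<` B)%classic.
    split; first by move=> y Ay; exists 0; rewrite scale0r subr0.
    move=> /(_ x) BA; apply: nAx; apply: BA.
    by exists 1; rewrite scale1r subrr.
  have BL a y z : B y -> B z -> B (a *: y + z).
    move=> [c Ac] [d Ad]; exists (a * c + d).
    rewrite scalerDl opprD addrACA -scalerA -scalerBr; exact: AL.
  have [c Ac] : B v by apply: contrapT => nBv; apply: (Amax B AB).
  have c0 : c != 0.
    by apply/eqP => c0; apply: Av; move: Ac; rewrite c0 scale0r subr0.
  exists c^-1; move: (AZ (- c^-1) _ Ac).
  by rewrite scalerBr scalerA mulNr mulVf // scaleN1r opprK scaleNr addrC.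
have [f fP] := choice ex.
have uniq x c : A (x - c *: v) -> c = f x.
  move=> Ac; apply/eqP; rewrite eq_sym -subr_eq0; apply/negPn/negP => d0; apply: Av.
  have := AZ (f x - c)^-1 _ (AL (-1) _ _ (fP x) Ac).
  rewrite scaleN1r opprB addrA subrK -scalerBl scalerA mulVf //.
  by rewrite scale1r.
exists f => [a x y|]; symmetry; apply: uniq; last by rewrite scale1r subrr.
by rewrite scalerDl opprD addrACA -scalerA -scalerBr; apply: AL.
Qed.

Lemma tens_neq0 (V W : lmodType k) (v : V) (w : W) :
  v != 0 -> w != 0 -> v ⊗t w != 0.
Proof.
move=> /exists_functional [f fL fv] /exists_functional [g gL gw].
pose h (x : V) (y : W) : k^o := f x * g y.
have hB : bilinear_map h.
  split=> [y a x x'|x a y y'] /=; rewrite /h.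
    by rewrite fL mulrDl scalerAl.
  by rewrite gL mulrDr scalerAr.
apply/eqP => vw0; have /eqP := tliftE v w hB.
by rewrite vw0 (lin0 (tlift_linear hB)) /h fv gw mulr1 eq_sym oner_eq0.
Qed.

End TensorNontrivial.

Section Lift2.
Variables (k : fieldType) (V W V' W' U : lmodType k).

(* Meaningful for 4-linear f only: v ⊗ w, v' ⊗ w' |-> f v w v' w'. *)
Definition tlift2 (f : V -> W -> V' -> W' -> U) (x : V ⊗ W) (y : V' ⊗ W') : U :=
  tlift (fun v w => tlift (f v w) y) x.

Variable f : V -> W -> V' -> W' -> U.
Hypothesis fBr : forall v w, bilinear_map (f v w).
Hypothesis fBl : forall v' w', bilinear_map (fun v w => f v w v' w').

Lemma tlift2_bilinearl y : bilinear_map (fun v w => tlift (f v w) y).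
Proof.
split=> [w a v v'|v a w w'] /=; rewrite -tlift_fun_linear;
  apply: eq_tlift => u u'.
  exact: (fBl u u').1.
exact: (fBl u u').2.
Qed.

Lemma tlift2_bilinear : bilinear_map (tlift2 f).
Proof.
split=> [y|x a y y'] /=; first exact: (tlift_linear (tlift2_bilinearl y)).
rewrite /tlift2 -tlift_fun_linear; apply: eq_tlift => v w.
exact: (tlift_linear (fBr v w)).
Qed.

Lemma tlift2E v w v' w' : tlift2 f (v ⊗t w) (v' ⊗t w') = f v w v' w'.
Proof. by rewrite /tlift2 tliftE ?tliftE //; apply: tlift2_bilinearl. Qed.

End Lift2.

Section TensorMap.
Variables (k : fieldType).

Definition tmap (V V' W W' : lmodType k) (f : V -> V') (g : W -> W') :
  V ⊗ W -> V' ⊗ W' := tlift (fun v w => f v ⊗t g w).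

Lemma tmap_bilinear (V V' W W' : lmodType k) (f : V -> V') (g : W -> W') :
  linear f -> linear g -> bilinear_map (fun v w => f v ⊗t g w).
Proof.
by move=> fL gL; split=> [w a v v'|v a w w'] /=; rewrite (fL, gL) (tensPl, tensPr).
Qed.

Lemma tmapE (V V' W W' : lmodType k) (f : V -> V') (g : W -> W') v w :
  linear f -> linear g -> tmap f g (v ⊗t w) = f v ⊗t g w.
Proof. by move=> fL gL; rewrite /tmap tliftE //; apply: tmap_bilinear. Qed.

Lemma tmap_linear (V V' W W' : lmodType k) (f : V -> V') (g : W -> W') :
  linear f -> linear g -> linear (tmap f g).
Proof. by move=> fL gL; apply/tlift_linear/tmap_bilinear. Qed.

Definition tassoc (U V W : lmodType k) : (U ⊗ V) ⊗ W -> U ⊗ (V ⊗ W) :=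
  tlift (fun x w => tlift (fun u v => u ⊗t (v ⊗t w)) x).

End TensorMap.

Section TensorAlgebra.
Variables (k : fieldType) (A B : algType k).

Definition tens_mul : A ⊗ B -> A ⊗ B -> A ⊗ B :=
  tlift2 (fun a b c d => (a * c) ⊗t (b * d)).
Definition tens_one : A ⊗ B := 1 ⊗t 1.

Lemma tens_mul_bilinear : bilinear_map tens_mul.
Proof.
apply: tlift2_bilinear => [a b|c d]; split=> [? ? ? ?|? ? ? ?] /=;
by rewrite (mulrDl, mulrDr) -(scalerAl, scalerAr) (tensPl, tensPr).
Qed.

Lemma tens_mulE a b c d : tens_mul (a ⊗t b) (c ⊗t d) = (a * c) ⊗t (b * d).
Proof.
apply: tlift2E => [{}a {}b|{}c {}d]; split=> [? ? ? ?|? ? ? ?] /=;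
by rewrite (mulrDl, mulrDr) -(scalerAl, scalerAr) (tensPl, tensPr).
Qed.

Let mulLl y : linear (tens_mul^~ y) := tens_mul_bilinear.1 y.
Let mulLr x : linear (tens_mul x) := tens_mul_bilinear.2 x.

Lemma tens_mulA : associative tens_mul.
Proof.
move=> x y z; move: x; apply: linear_tens_eq => [||a b].
- exact: mulLl.
- exact: (lin_comp (mulLl _) (mulLl _)).
move: y; apply: linear_tens_eq => [||c d].
- exact: (lin_comp (mulLr _) (mulLl _)).
- exact: (lin_comp (mulLl _) (mulLr _)).
move: z; apply: linear_tens_eq => [||e f].
- exact: (lin_comp (mulLr _) (mulLr _)).
- exact: mulLr.
by rewrite !tens_mulE !mulrA.
Qed.

Lemma tens_mul1r : left_id tens_one tens_mul.
Proof.
apply: linear_tens_eq => [||a b]; [exact: mulLr|exact: lin_id|].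
by rewrite tens_mulE !mul1r.
Qed.

Lemma tens_mulr1 : right_id tens_one tens_mul.
Proof.
apply: linear_tens_eq => [||a b]; [exact: mulLl|exact: lin_id|].
by rewrite tens_mulE !mulr1.
Qed.

Lemma tens_mulDl : left_distributive tens_mul +%R.
Proof. by move=> x y z; apply: (linD (mulLl z)). Qed.

Lemma tens_mulDr : right_distributive tens_mul +%R.
Proof. by move=> x y z; apply: (linD (mulLr x)). Qed.

Lemma tens_one_neq0 : tens_one != 0.
Proof. by apply: tens_neq0; apply: oner_neq0. Qed.

HB.instance Definition _ := GRing.Zmodule_isNzRing.Build (A ⊗ B)
  tens_mulA tens_mul1r tens_mulr1 tens_mulDl tens_mulDr tens_one_neq0.

Fact tens_scaleAl (a : k) (x y : A ⊗ B) : a *: (x * y) = (a *: x) * y.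
Proof. by rewrite [RHS](linZ (mulLl y)). Qed.

HB.instance Definition _ := GRing.Lmodule_isLalgebra.Build k (A ⊗ B) tens_scaleAl.

Fact tens_scaleAr (a : k) (x y : A ⊗ B) : a *: (x * y) = x * (a *: y).
Proof. by rewrite [RHS](linZ (mulLr x)). Qed.

HB.instance Definition _ := GRing.Lalgebra_isAlgebra.Build k (A ⊗ B) tens_scaleAr.

End TensorAlgebra.

HB.mixin Record Algebra_isGraded (k : fieldType) (V : Type)
    of GRing.Algebra k V := {
  gcomp : nat -> V -> V;
  gcomp_linear : forall n, linear (gcomp n);
  gcomp_comp : forall m n x, gcomp m (gcomp n x) = if m == n then gcomp n x else 0;
  gcomp_sum : forall x, exists N, x = \sum_(n < N) gcomp n x;
  gcomp1 : gcomp 0 1 = 1;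
  gcompM : forall m n x y,
    gcomp (m + n) (gcomp m x * gcomp n y) = gcomp m x * gcomp n y
}.

#[short(type="gradedAlgType")]
HB.structure Definition GradedAlgebra (k : fieldType) :=
  { V of GRing.Algebra k V & Algebra_isGraded k V }.

Section Graded.
Variables (k : fieldType) (A : gradedAlgType k).
Implicit Types (x y : A).

Definition homog n x : Prop := gcomp n x = x.

(* Some N such that all components of x lie in degrees below N. *)
Definition gbound x : nat := projT1 (cid (gcomp_sum x)).

Definition ginvol x : A := \sum_(n < gbound x) (-1) ^+ n *: gcomp n x.

Lemma gbound_sum x : x = \sum_(n < gbound x) gcomp n x.
Proof. exact: projT2 (cid (gcomp_sum x)). Qed.

Lemma gcomp_ge x N : x = \sum_(n < N) gcomp n x ->
  forall n, (N <= n)%N -> gcomp n x = 0.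
Proof.
move=> xE n leNn; rewrite xE (lin_sum _ _ _ (gcomp_linear n)) big1 // => i _.
by rewrite gcomp_comp gtn_eqF // (leq_trans (ltn_ord i)).
Qed.

Lemma gcomp_bound x n : (gbound x <= n)%N -> gcomp n x = 0.
Proof. exact: gcomp_ge (gbound_sum x) n. Qed.

Lemma gsum_bound (V : lmodType k) (F : nat -> A -> V) x N :
    (forall n, F n 0 = 0) -> (gbound x <= N)%N ->
  \sum_(n < gbound x) F n (gcomp n x) = \sum_(n < N) F n (gcomp n x).
Proof.
move=> F0 leN; rewrite -!(big_mkord xpredT (fun n => F n (gcomp n x))).
rewrite [RHS](big_cat_nat (leq0n (gbound x)) leN) /= [X in _ + X]big1_seq ?addr0 // => i.
by rewrite mem_index_iota => /andP[_ /andP[le_i _]]; rewrite gcomp_bound.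
Qed.

Lemma gcomp_sumE x N : (gbound x <= N)%N -> x = \sum_(n < N) gcomp n x.
Proof.
by move=> leN; rewrite -(gsum_bound (F := fun _ y => y)) //; apply: gbound_sum.
Qed.

Lemma gcomp_homog n x : homog n (gcomp n x).
Proof. by rewrite /homog gcomp_comp eqxx. Qed.

Lemma homog_comp m n x : homog n x -> gcomp m x = if m == n then x else 0.
Proof. by move=> <-; rewrite gcomp_comp. Qed.

Lemma homog_ind (P : A -> Prop) :
  P 0 -> (forall n x, homog n x -> P x) -> (forall x y, P x -> P y -> P (x + y)) ->
  forall x, P x.
Proof.
move=> P0 Ph PD x; rewrite (gcomp_sumE (leqnn (gbound x))).
by elim/big_ind: _ => // i _; apply/Ph/gcomp_homog.
Qed.

Lemma linear_homog_eq (V : lmodType k) (f g : A -> V) : linear f -> linear g ->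
  (forall n x, homog n x -> f x = g x) -> f =1 g.
Proof.
move=> fL gL fg; apply: homog_ind => [|n x|x y hx hy].
- by rewrite !lin0.
- exact: fg.
- by rewrite !linD // hx hy.
Qed.

Lemma ginvol_bound x N : (gbound x <= N)%N ->
  ginvol x = \sum_(n < N) (-1) ^+ n *: gcomp n x.
Proof. by apply: (gsum_bound (F := fun n y => (-1) ^+ n *: y)) => n; apply: scaler0. Qed.

Lemma ginvol_linear : linear ginvol.
Proof.
move=> a x y; set N := maxn (gbound (a *: x + y)) (maxn (gbound x) (gbound y)).
rewrite !(ginvol_bound (N := N)) ?leq_max ?leqnn ?orbT //.
rewrite scaler_sumr -big_split; apply: eq_bigr => n _ /=.
by rewrite gcomp_linear scalerDr !scalerA mulrC.
Qed.

Lemma ginvol_homog n x : homog n x -> ginvol x = (-1) ^+ n *: x.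
Proof.
move=> hx; have lt_n : (n < gbound x + n.+1)%N by rewrite addnS ltnS leq_addl.
rewrite (ginvol_bound (leq_addr n.+1 (gbound x))) (bigD1 (Ordinal lt_n)) //= hx.
rewrite big1 ?addr0 // => i /eqP neq_i; rewrite (homog_comp _ hx).
by case: eqP => [ni|_]; [case: neq_i; apply: val_inj|rewrite scaler0].
Qed.

Lemma homogM m n x y : homog m x -> homog n y -> homog (m + n) (x * y).
Proof. by move=> <- <-; apply: gcompM. Qed.

Lemma homog0 n : homog n (0 : A).
Proof. exact: lin0 (gcomp_linear n). Qed.

Lemma homog1 : homog 0 (1 : A).
Proof. exact: gcomp1. Qed.

End Graded.

Section Koszul.
Variables (k : fieldType) (A B : gradedAlgType k) (U : lmodType k).

(* For bilinear f, the bilinear map sending homogeneous a and b to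
   (-1)^(|a| |b|) f a b. *)
Definition koszul (f : A -> B -> U) (a : A) (b : B) : U :=
  \sum_(i < gbound a) \sum_(j < gbound b)
    (-1) ^+ (i * j) *: f (gcomp i a) (gcomp j b).

Lemma koszul_bound (f : A -> B -> U) a b M N : bilinear_map f ->
    (gbound a <= M)%N -> (gbound b <= N)%N ->
  koszul f a b =
  \sum_(i < M) \sum_(j < N) (-1) ^+ (i * j) *: f (gcomp i a) (gcomp j b).
Proof.
move=> [fl fr] leM leN; rewrite /koszul.
pose F n (a' : A) := \sum_(j < gbound b) (-1) ^+ (n * j) *: f a' (gcomp j b).
rewrite (gsum_bound (F := F) (x := a) _ leM) => [|n]; last first.
  by rewrite /F big1 // => j _; rewrite (lin0 (fl _)) scaler0.
apply: eq_bigr => i _; rewrite /F.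
rewrite (gsum_bound (F := fun j b' => (-1) ^+ (i * j) *: f (gcomp i a) b') _ leN) //.
by move=> n; rewrite (lin0 (fr _)) scaler0.
Qed.

Lemma koszul_bilinear (f : A -> B -> U) : bilinear_map f -> bilinear_map (koszul f).
Proof.
move=> fB; have [fl fr] := fB; split=> [b c a a'|a c b b'] /=.
  set M := maxn (gbound (c *: a + a')) (maxn (gbound a) (gbound a')).
  rewrite !(koszul_bound (M := M) (N := gbound b)) ?leq_max ?leqnn ?orbT //.
  rewrite scaler_sumr -big_split; apply: eq_bigr => i _ /=.
  rewrite scaler_sumr -big_split; apply: eq_bigr => j _ /=.
  by rewrite gcomp_linear fl scalerDr !scalerA mulrC.
set N := maxn (gbound (c *: b + b')) (maxn (gbound b) (gbound b')).
rewrite !(koszul_bound (M := gbound a) (N := N)) ?leq_max ?leqnn ?orbT //.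
rewrite scaler_sumr -big_split; apply: eq_bigr => i _ /=.
rewrite scaler_sumr -big_split; apply: eq_bigr => j _ /=.
by rewrite gcomp_linear fr scalerDr !scalerA mulrC.
Qed.

Lemma koszul_homog (f : A -> B -> U) m n a b : bilinear_map f ->
  homog m a -> homog n b -> koszul f a b = (-1) ^+ (m * n) *: f a b.
Proof.
move=> fB ha hb; have [fl fr] := fB.
pose M := (gbound a + m.+1)%N; pose N := (gbound b + n.+1)%N.
rewrite (koszul_bound (M := M) (N := N)) ?leq_addr //.
have ltM : (m < M)%N by rewrite /M addnS ltnS leq_addl.
have ltN : (n < N)%N by rewrite /N addnS ltnS leq_addl.
rewrite (bigD1 (Ordinal ltM)) //= [X in _ + X]big1 ?addr0 => [|i /eqP neq_i].
  rewrite (bigD1 (Ordinal ltN)) //= [X in _ + X]big1 ?addr0 => [|j /eqP neq_j].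
    by rewrite ha hb.
  rewrite (homog_comp _ hb); case: eqP => [jn|_]; last by rewrite (lin0 (fr _)) scaler0.
  by case: neq_j; apply: val_inj.
apply: big1 => j _; rewrite (homog_comp _ ha); case: eqP => [im|_].
  by case: neq_i; apply: val_inj.
by rewrite (lin0 (fl _)) scaler0.
Qed.

Lemma koszul_fun_linear c (f g : A -> B -> U) a b :
  koszul (fun a b => c *: f a b + g a b) a b = c *: koszul f a b + koszul g a b.
Proof.
rewrite /koszul scaler_sumr -big_split; apply: eq_bigr => i _ /=.
rewrite scaler_sumr -big_split; apply: eq_bigr => j _ /=.
by rewrite scalerDr !scalerA mulrC.
Qed.

Lemma eq_koszul (f g : A -> B -> U) a b : f =2 g -> koszul f a b = koszul g a b.
Proof. by move=> fg; apply: eq_bigr => i _; apply: eq_bigr => j _; rewrite fg. Qed.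

End Koszul.

Section SuperTensor.
Variables (k : fieldType) (A B : gradedAlgType k).

(* A copy of A ⊗ B carrying the super tensor product algebra structure and the
   total degree. *)
Definition stensor : Type := A ⊗ B.

HB.instance Definition _ := GRing.Lmodule.on stensor.

(* (a ⊗ b)(c ⊗ d) = (-1)^(|b| |c|) ac ⊗ bd *)
Definition stens_mul : stensor -> stensor -> stensor :=
  tlift2 (fun a b c d => koszul (fun (b : B) (c : A) => (a * c) ⊗t (b * d)) b c).
Definition stens_one : stensor := 1 ⊗t 1.

Let innerB a d : bilinear_map (fun (b : B) (c : A) => (a * c) ⊗t (b * d)).
Proof.
by split=> [? ? ? ?|? ? ? ?] /=;
  rewrite (mulrDl, mulrDr) -(scalerAl, scalerAr) (tensPl, tensPr).
Qed.

Let mulBr a b : bilinear_map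
  (fun c d => koszul (fun (b : B) (c : A) => (a * c) ⊗t (b * d)) b c).
Proof.
split=> [d x c c'|c x d d'] /=; first exact: (koszul_bilinear (innerB a d)).2.
rewrite -koszul_fun_linear; apply: eq_koszul => u v.
by rewrite mulrDr -scalerAr tensPr.
Qed.

Let mulBl c d : bilinear_map
  (fun a b => koszul (fun (b : B) (c : A) => (a * c) ⊗t (b * d)) b c).
Proof.
split=> [b x a a'|a x b b'] /=; last exact: (koszul_bilinear (innerB a d)).1.
rewrite -koszul_fun_linear; apply: eq_koszul => u v.
by rewrite mulrDl -scalerAl tensPl.
Qed.

Lemma stens_mul_bilinear : bilinear_map stens_mul.
Proof. exact: tlift2_bilinear mulBr mulBl. Qed.

Lemma stens_mulE m n a b c d : homog m b -> homog n c ->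
  stens_mul (a ⊗t b) (c ⊗t d) = (-1) ^+ (m * n) *: ((a * c) ⊗t (b * d)).
Proof.
by move=> hb hc; rewrite [LHS](tlift2E mulBr mulBl) (koszul_homog (innerB _ _) hb hc).
Qed.

Let mulLl y : linear (stens_mul^~ y) := stens_mul_bilinear.1 y.
Let mulLr x : linear (stens_mul x) := stens_mul_bilinear.2 x.

Lemma stens_linear_eq (U : lmodType k) (f g : stensor -> U) :
    linear f -> linear g ->
    (forall m n a b, homog m a -> homog n b -> f (a ⊗t b) = g (a ⊗t b)) ->
  f =1 g.
Proof.
move=> fL gL fg; apply: (linear_tens_eq fL gL) => a b; move: a.
have lL (h : stensor -> U) : linear h -> linear (fun a : A => h (a ⊗t b)).
  by move=> hL; apply: (lin_comp (h := tens^~ b) hL ((tens_bilinear A B).1 b)).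
apply: linear_homog_eq => [||m a ha]; [exact: lL|exact: lL|]; move: b {lL}.
have lL (h : stensor -> U) : linear h -> linear (fun b : B => h (a ⊗t b)).
  by move=> hL; apply: (lin_comp (h := tens a) hL ((tens_bilinear A B).2 a)).
by apply: linear_homog_eq => [||n b hb]; [exact: lL|exact: lL|apply: fg ha hb].
Qed.

Lemma stens_mulA : associative stens_mul.
Proof.
move=> x y z; move: x; apply: stens_linear_eq => [||m n a b ha hb].
- exact: mulLl.
- exact: (lin_comp (mulLl _) (mulLl _)).
move: y; apply: stens_linear_eq => [||p q c d hc hd].
- exact: (lin_comp (mulLr _) (mulLl _)).
- exact: (lin_comp (mulLl _) (mulLr _)).
move: z; apply: stens_linear_eq => [||r s e f he hf].
- exact: (lin_comp (mulLr _) (mulLr _)).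
- exact: mulLr.
rewrite (stens_mulE _ _ hb hc) (stens_mulE _ _ hd he).
rewrite (linZ (mulLr _)) (linZ (mulLl _)) /=.
rewrite (stens_mulE _ _ hb (homogM hc he)) (stens_mulE _ _ (homogM hb hd) he).
rewrite !scalerA -!exprD !mulrA; congr ((-1) ^+ _ *: _).
by rewrite mulnDr mulnDl addnC addnA.
Qed.

Lemma stens_mul1r : left_id stens_one stens_mul.
Proof.
apply: stens_linear_eq => [||m n a b ha hb]; [exact: mulLr|exact: lin_id|].
by rewrite (stens_mulE _ _ (homog1 B) ha) mul0n scale1r !mul1r.
Qed.

Lemma stens_mulr1 : right_id stens_one stens_mul.
Proof.
apply: stens_linear_eq => [||m n a b ha hb]; [exact: mulLl|exact: lin_id|].
by rewrite (stens_mulE _ _ hb (homog1 A)) muln0 scale1r !mulr1.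
Qed.

Lemma stens_mulDl : left_distributive stens_mul +%R.
Proof. by move=> x y z; apply: (linD (mulLl z)). Qed.

Lemma stens_mulDr : right_distributive stens_mul +%R.
Proof. by move=> x y z; apply: (linD (mulLr x)). Qed.

Lemma stens_one_neq0 : stens_one != 0.
Proof. by apply: tens_neq0; apply: oner_neq0. Qed.

HB.instance Definition _ := GRing.Zmodule_isNzRing.Build stensor
  stens_mulA stens_mul1r stens_mulr1 stens_mulDl stens_mulDr stens_one_neq0.

Fact stens_scaleAl (a : k) (x y : stensor) : a *: (x * y) = (a *: x : stensor) * y.
Proof. exact: esym (linZ (mulLl y) a x). Qed.

HB.instance Definition _ := GRing.Lmodule_isLalgebra.Build k stensor stens_scaleAl.

Fact stens_scaleAr (a : k) (x y : stensor) : a *: (x * y) = x * (a *: y : stensor).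
Proof. exact: esym (linZ (mulLr x) a y). Qed.

HB.instance Definition _ := GRing.Lalgebra_isAlgebra.Build k stensor stens_scaleAr.

Definition stens_comp n (x : stensor) : stensor :=
  \sum_(i < n.+1) tmap (gcomp i) (gcomp (n - i)) x.

Lemma stens_comp_linear n : linear (stens_comp n).
Proof.
move=> a x y; rewrite /stens_comp scaler_sumr -big_split.
apply: eq_bigr => i _ /=; apply: tmap_linear; exact: gcomp_linear.
Qed.

Lemma stens_compE n i j a b : homog i a -> homog j b ->
  stens_comp n (a ⊗t b) = if n == (i + j)%N then a ⊗t b else 0.
Proof.
move=> ha hb; rewrite /stens_comp.
under eq_bigr => l _.
  rewrite (tmapE _ _ (gcomp_linear _) (gcomp_linear _)).
  rewrite (homog_comp _ ha) (homog_comp _ hb); over.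
case: eqP => [->|neq].
  have lt_i : (i < (i + j).+1)%N by rewrite ltnS leq_addr.
  rewrite (bigD1 (Ordinal lt_i)) //= addKn !eqxx big1 ?addr0 // => l /eqP neq_l.
  by case: eqP => [li|_]; [case: neq_l; apply: val_inj|rewrite tens0l].
apply: big1 => l _; case: eqP => [li|_]; last by rewrite tens0l.
case: eqP => [nj|_]; last by rewrite tens0r.
by case: neq; rewrite -nj -li subnKC // -ltnS.
Qed.

Lemma stens_comp_comp m n x :
  stens_comp m (stens_comp n x) = if m == n then stens_comp n x else 0.
Proof.
have Lc := stens_comp_linear; move: x; apply: stens_linear_eq => [||i j a b ha hb].
- exact: lin_comp (Lc m) (Lc n).
- case: eqP => _; first exact: Lc.
  by move=> c u v; rewrite scaler0 addr0.
rewrite !(stens_compE _ ha hb); case: (n =P (i + j)%N) => [->|_].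
  by rewrite (stens_compE _ ha hb).
by rewrite (lin0 (Lc m)) if_same.
Qed.

Lemma stens_comp_sum x : exists N, x = \sum_(n < N) stens_comp n x.
Proof.
suff [N /(_ N (leqnn N))] :
    exists N, forall M, (N <= M)%N -> x = \sum_(n < M) stens_comp n x.
  by exists N.
move: x; pose P (x : stensor) :=
  exists N, forall M, (N <= M)%N -> x = \sum_(n < M) stens_comp n x.
have PD x y : P x -> P y -> P (x + y).
  move=> [M hM] [N hN]; exists (maxn M N) => L; rewrite geq_max => /andP[leM leN].
  rewrite {1}(hM _ leM) {1}(hN _ leN) -big_split; apply: eq_bigr => n _ /=.
  by rewrite (linD (stens_comp_linear n)).
have P0 : P 0.
  by exists 0 => M _; rewrite big1 // => n _; apply: lin0 (stens_comp_linear n).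
apply: (tens_ind (P := P)) => // a b.
elim/homog_ind: a => [|i a ha|a a' Pa Pa'].
- by rewrite tens0l.
- elim/homog_ind: b => [|j b hb|b b' Pb Pb'].
  + by rewrite tens0r.
  + exists (i + j).+1 => M ltM; rewrite (bigD1 (Ordinal ltM)) //= big1.
      by rewrite addr0 (stens_compE _ ha hb) eqxx.
    move=> n /eqP neq_n; rewrite (stens_compE _ ha hb); case: eqP => // nE.
    by case: neq_n; apply: val_inj.
  + by rewrite (linD (h := tens a) ((tens_bilinear A B).2 a)); apply: PD.
- by rewrite (linD (h := tens^~ b) ((tens_bilinear A B).1 b)); apply: PD.
Qed.

Lemma stens_comp1 : stens_comp 0 1 = 1.
Proof. by rewrite [LHS](stens_compE _ (homog1 A) (homog1 B)). Qed.

Lemma stens_compM m n x y : stens_comp (m + n) (stens_comp m x * stens_comp n y) =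
  stens_comp m x * stens_comp n y.
Proof.
have Lc := stens_comp_linear; move: x; apply: stens_linear_eq => [||i j a b ha hb].
- exact: lin_comp (Lc _) (lin_comp (mulLl _) (Lc _)).
- exact: lin_comp (mulLl _) (Lc _).
move: y; apply: stens_linear_eq => [||p q c d hc hd].
- exact: lin_comp (Lc _) (lin_comp (mulLr _) (Lc _)).
- exact: lin_comp (mulLr _) (Lc _).
rewrite (stens_compE _ ha hb) (stens_compE _ hc hd).
case: eqP => [->|_]; last by rewrite mul0r (lin0 (Lc _)).
case: eqP => [->|_]; last by rewrite mulr0 (lin0 (Lc _)).
rewrite [X in stens_comp _ X](stens_mulE _ _ hb hc) [RHS](stens_mulE _ _ hb hc).
rewrite (linZ (Lc _)) (stens_compE _ (homogM ha hc) (homogM hb hd)).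
by rewrite addnACA eqxx.
Qed.

HB.instance Definition _ := Algebra_isGraded.Build k stensor stens_comp_linear
  stens_comp_comp stens_comp_sum stens_comp1 stens_compM.

End SuperTensor.

Notation "A ⊗s B" := (stensor A B) : type_scope.

Section Coalgebras.
Variables (k : fieldType).

Record is_coalgebra (C : lmodType k) (Delta : C -> C ⊗ C) (eps : C -> k) : Prop := {
  coalg_linear : linear Delta;
  coalg_counit_linear : scalar eps;
  coalg_coassoc : forall c, tassoc (tmap Delta id (Delta c)) = tmap id Delta (Delta c);
  coalg_counitl : forall c, tlift (fun x y => eps x *: y) (Delta c) = c;
  coalg_counitr : forall c, tlift (fun x y => eps y *: x) (Delta c) = c
}.

Record is_right_coaction (V C : lmodType k) (Delta : C -> C ⊗ C) (eps : C -> k)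
    (alpha : V -> V ⊗ C) : Prop := {
  rcoact_linear : linear alpha;
  rcoact_coassoc : forall v,
    tassoc (tmap alpha id (alpha v)) = tmap id Delta (alpha v);
  rcoact_counit : forall v, tlift (fun x c => eps c *: x) (alpha v) = v
}.

Record is_left_coaction (V C : lmodType k) (Delta : C -> C ⊗ C) (eps : C -> k)
    (beta : V -> C ⊗ V) : Prop := {
  lcoact_linear : linear beta;
  lcoact_coassoc : forall v,
    tassoc (tmap Delta id (beta v)) = tmap id beta (beta v);
  lcoact_counit : forall v, tlift (fun c x => eps c *: x) (beta v) = v
}.

(* No sign appears in the super case either. *)
Record is_antipode (A : algType k) (Delta : A -> A ⊗ A) (eps : A -> k)
    (S : A -> A) : Prop := {
  antipode_linear : linear S;
  antipodel : forall a, tlift (fun x y => S x * y) (Delta a) = eps a *: 1;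
  antipoder : forall a, tlift (fun x y => x * S y) (Delta a) = eps a *: 1
}.

End Coalgebras.

Section Bialgebras.
Variables (k : fieldType) (A : algType k) (Delta : A -> A ⊗ A) (eps : A -> k).

Record is_bialgebra : Prop := {
  bialg_coalgebra : is_coalgebra Delta eps;
  bialg_comul : monoid_morphism Delta;
  bialg_counit : monoid_morphism eps
}.

Definition is_hopf : Prop := is_bialgebra /\ exists S, is_antipode Delta eps S.

End Bialgebras.

Section SuperBialgebras.
Variables (k : fieldType).

(* x lies in the even (b = false) or odd (b = true) part, the super grade being
   the degree mod 2. *)
Definition has_parity (X : gradedAlgType k) (b : bool) (x : X) : Prop :=
  forall n, odd n != b -> gcomp n x = 0.

Definition parity_preserving (X Y : gradedAlgType k) (f : X -> Y) : Prop :=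
  forall b x, has_parity b x -> has_parity b (f x).

Variables (X : gradedAlgType k) (Delta : X -> X ⊗s X) (eps : X -> k).

Record is_super_bialgebra : Prop := {
  sbialg_coalgebra : is_coalgebra Delta eps;
  sbialg_comul : monoid_morphism Delta;
  sbialg_counit : monoid_morphism eps;
  sbialg_comul_even : parity_preserving Delta;
  sbialg_counit_even : forall x, has_parity true x -> eps x = 0
}.

Definition is_super_hopf : Prop := is_super_bialgebra /\
  exists S, is_antipode Delta eps S /\ parity_preserving S.

End SuperBialgebras.

Section ExteriorAlgebras.
Variables (k : fieldType).

(* The subalgebra A = Omega^0 is given by its inclusion iota. *)
Record is_exterior_algebra (A : algType k) (X : gradedAlgType k)
    (iota : A -> X) (d : X -> X) : Prop := {
  ext_incl_linear : linear iota;
  ext_incl_mul : monoid_morphism iota;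
  ext_incl_inj : injective iota;
  ext_degree0 : forall x, homog 0 x <-> exists a, x = iota a;
  ext_d_linear : linear d;
  ext_d_degree : forall n x, homog n x -> homog n.+1 (d x);
  ext_d_square : forall x, d (d x) = 0;
  ext_leibniz : forall n x y, homog n x ->
    d (x * y) = d x * y + (-1) ^+ n *: (x * d y);
  ext_degree1 : forall x, homog 1 x <->
    exists s : seq (A * A), x = \sum_(p <- s) iota p.1 * d (iota p.2);
  ext_generated : forall S : {pred X}, subalg_closed S ->
    (forall a, iota a \in S) -> (forall x, homog 1 x -> x \in S) ->
    forall x, x \in S
}.

(* d ⊗ id + (-1)^| | ⊗ d' *)
Definition stens_diff (X Y : gradedAlgType k) (d : X -> X) (d' : Y -> Y) :
  X ⊗s Y -> X ⊗s Y := tlift (fun x y => d x ⊗t y + ginvol x ⊗t d' y).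

Lemma stens_diffE (X Y : gradedAlgType k) (d : X -> X) (d' : Y -> Y) n x y :
    linear d -> linear d' -> homog n x ->
  stens_diff d d' (x ⊗t y) = d x ⊗t y + (-1) ^+ n *: (x ⊗t d' y).
Proof.
move=> dL dL' hx; rewrite /stens_diff tliftE.
  by rewrite (ginvol_homog hx) (linZ (h := tens^~ _) ((tens_bilinear X Y).1 _)).
split=> [v a u u'|u a v v'] /=; first rewrite dL ginvol_linear !tensPl.
  by rewrite scalerDr addrACA.
by rewrite dL' !tensPr scalerDr addrACA.
Qed.

(* gamma_s extends gamma : U -> V ⊗ W to the exterior algebras, preserves the
   total degree and commutes with the differentials. *)
Record is_differentiable (U V W : algType k) (XU XV XW : gradedAlgType k)
    (iotaU : U -> XU) (iotaV : V -> XV) (iotaW : W -> XW)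
    (dU : XU -> XU) (dV : XV -> XV) (dW : XW -> XW)
    (gamma : U -> V ⊗ W) (gamma_s : XU -> XV ⊗s XW) : Prop := {
  diff_degree : forall n x, homog n x -> homog n (gamma_s x);
  diff_extends : forall u, gamma_s (iotaU u) = tmap iotaV iotaW (gamma u);
  diff_d : forall x, gamma_s (dU x) = stens_diff dV dW (gamma_s x)
}.

Section StronglyBicovariant.
Variables (A : algType k) (Delta : A -> A ⊗ A) (eps : A -> k).
Variables (X : gradedAlgType k) (iota : A -> X) (d : X -> X).
Variables (Delta_s : X -> X ⊗s X) (eps_s : X -> k).

Record is_strongly_bicovariant : Prop := {
  sbicov_base : is_bialgebra Delta eps;
  sbicov_exterior : is_exterior_algebra iota d;
  sbicov_super : is_super_bialgebra Delta_s eps_s;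
  sbicov_diff : is_differentiable iota iota iota d d d Delta Delta_s
}.

Record is_strongly_bicovariant_hopf : Prop := {
  sbicovh_base : is_hopf Delta eps;
  sbicovh_exterior : is_exterior_algebra iota d;
  sbicovh_super : is_super_hopf Delta_s eps_s;
  sbicovh_diff : is_differentiable iota iota iota d d d Delta Delta_s
}.

End StronglyBicovariant.
End ExteriorAlgebras.

Section DoubleCrossCoproduct.
Variables (k : fieldType) (A H : algType k).
Variables (DeltaA : A -> A ⊗ A) (epsA : A -> k).
Variables (DeltaH : H -> H ⊗ H) (epsH : H -> k).
Variables (alpha : A -> A ⊗ H) (beta : H -> A ⊗ H).

Record dcc_compatible : Prop := {
  dcc_compatA : forall a, tassoc (tmap DeltaA id (alpha a)) =
    tlift (fun a1 a2 => (tmap id beta (alpha a1) : A ⊗ (A ⊗ H)) *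
                        ((1 : A) ⊗t alpha a2 : A ⊗ (A ⊗ H))) (DeltaA a);
  dcc_compatH : forall h, tmap id DeltaH (beta h) =
    tassoc (tlift (fun h1 h2 => (beta h1 ⊗t (1 : H) : (A ⊗ H) ⊗ H) *
                                (tmap alpha id (beta h2) : (A ⊗ H) ⊗ H))
                  (DeltaH h));
  dcc_compatC : forall a h, alpha a * beta h = beta h * alpha a
}.

(* h ⊗ a |-> h1 ⊗ alpha(a1) beta(h2) ⊗ a2, rebracketed *)
Definition dcc_comul : H ⊗ A -> (H ⊗ A) ⊗ (H ⊗ A) :=
  tlift (fun h a => tlift2 (fun h1 h2 a1 a2 =>
    tlift (fun x g => (h1 ⊗t x) ⊗t (g ⊗t a2)) (alpha a1 * beta h2))
    (DeltaH h) (DeltaA a)).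

Definition dcc_counit : H ⊗ A -> k := tlift (U := k^o) (fun h a => epsH h * epsA a).

(* The last clause is not redundant for bialgebras: the counit axioms of H ⊗ A
   force (epsA ⊗ id) alpha = epsA 1 and (id ⊗ epsH) beta = epsH 1, which do not
   follow from the other clauses. *)
Record is_double_cross_coproduct : Prop := {
  dcc_bialgA : is_bialgebra DeltaA epsA;
  dcc_bialgH : is_bialgebra DeltaH epsH;
  dcc_right_coaction : is_right_coaction DeltaH epsH alpha;
  dcc_right_mul : monoid_morphism alpha;
  dcc_left_coaction : is_left_coaction DeltaA epsA beta;
  dcc_left_mul : monoid_morphism beta;
  dcc_compat : dcc_compatible;
  dcc_bialg : is_bialgebra dcc_comul dcc_counit
}.

End DoubleCrossCoproduct.

Section SuperDoubleCrossCoproduct.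
Variables (k : fieldType) (X Y : gradedAlgType k).
Variables (DeltaX : X -> X ⊗s X) (epsX : X -> k).
Variables (DeltaY : Y -> Y ⊗s Y) (epsY : Y -> k).
Variables (alpha : X -> X ⊗s Y) (beta : Y -> X ⊗s Y).

Record is_super_right_comodule_algebra : Prop := {
  srcoact_coaction : is_right_coaction DeltaY epsY alpha;
  srcoact_mul : monoid_morphism alpha;
  srcoact_even : parity_preserving alpha
}.

Record is_super_left_comodule_algebra : Prop := {
  slcoact_coaction : is_left_coaction DeltaX epsX beta;
  slcoact_mul : monoid_morphism beta;
  slcoact_even : parity_preserving beta
}.

Record sdcc_compatible : Prop := {
  sdcc_compatX : forall w, tassoc (tmap DeltaX id (alpha w)) =
    tlift (fun w1 w2 => (tmap id beta (alpha w1) : X ⊗s (X ⊗s Y)) *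
                        ((1 : X) ⊗t alpha w2 : X ⊗s (X ⊗s Y))) (DeltaX w);
  sdcc_compatY : forall e, tmap id DeltaY (beta e) =
    tassoc (tlift (fun e1 e2 => (beta e1 ⊗t (1 : Y) : (X ⊗s Y) ⊗s Y) *
                                (tmap alpha id (beta e2) : (X ⊗s Y) ⊗s Y))
                  (DeltaY e));
  sdcc_compatC : forall m n w e, homog m w -> homog n e ->
    alpha w * beta e = (-1) ^+ (m * n) *: (beta e * alpha w)
}.

(* e ⊗ w |-> (-1)^(|w1| |e2|) e1 ⊗ alpha(w1) beta(e2) ⊗ w2, rebracketed *)
Definition sdcc_comul : Y ⊗s X -> (Y ⊗s X) ⊗s (Y ⊗s X) :=
  tlift (fun e w => tlift2 (fun e1 e2 w1 w2 =>
    koszul (fun (w1 : X) (e2 : Y) =>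
      tlift (fun x g => (e1 ⊗t x) ⊗t (g ⊗t w2)) (alpha w1 * beta e2)) w1 e2)
    (DeltaY e) (DeltaX w)).

Definition sdcc_counit : Y ⊗s X -> k := tlift (U := k^o) (fun e w => epsY e * epsX w).

End SuperDoubleCrossCoproduct.

(* Main.v *)
Require Import Defs.
From HB Require Import structures.
From mathcomp Require Import all_boot all_order all_algebra.
From mathcomp Require Import boolp.

Set Implicit Arguments.
Unset Strict Implicit.
Unset Printing Implicit Defensive.

Import GRing.Theory.
Local Open Scope ring_scope.

(** The proof replaces signed Sweedler computations by the universal property of
    the super tensor product together with the fact that an exterior algebra is
    generated by its degree 0 part and the differentials of that part.

    Universal property ([tmul_dgmap]): two maps of differential graded algebras
    with super-commuting images induce one on the super tensor product, namely
    x ⊗ y |-> f x * g y.  The super double cross coproduct is of this kind.  In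
    T = (OH ⊗ OA) ⊗ (OH ⊗ OA) the four tensor legs super-commute pairwise, and

      Delta(eta ⊗ omega) = F(eta) G(omega),
      F(eta) = eta1 ⊗ beta(eta2) ⊗ 1,   G(omega) = 1 ⊗ alpha(omega1) ⊗ omega2.

    The sign in the definition of Delta is the one produced by moving
    alpha(omega1) past beta(eta2), which is what the third compatibility
    condition says ([sdcc_comulE]); the same condition makes the images of F and
    G super-commute ([comulY_comulX]).  Hence Delta is a map of differential
    graded algebras.

    Generation ([ext_dgmap_eq]): maps of differential graded algebras out of an
    exterior algebra agree as soon as they agree in degree 0.  Both sides of the
    coassociativity and counit axioms are such maps once the counit is known to
    vanish in positive degree ([counit_pos]), and OH ⊗ OA is an exterior algebra
    on H ⊗ A ([tens_exterior]).  So these axioms follow from those of the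
    bialgebra H ⊗ A ([ext_coalgebra]).

    Antipode: put p_H = id ⊗ eps and p_A = eps ⊗ id, and let i_H, i_A be the
    inclusions of the two tensor factors.  In the convolution algebra the
    identity of OH ⊗ OA is the product (i_H p_H) * (i_A p_A).  Since p_H and p_A
    are coalgebra maps and i_H and i_A algebra maps, both factors are invertible,
    with inverses i_H S_H p_H and i_A S_A p_A.  So the antipode is the product of
    these inverses in reverse order ([factor_antipodeP]).  The antipode of H ⊗ A
    is the super one restricted to degree 0 and followed by the projection onto
    degree 0, which is an algebra map ([restrict_antipode]). *)

(** * Tensors and algebra maps *)

Section AlgebraMaps.
Variable k : fieldType.

Lemma signZK n (V : lmodType k) (v : V) : (-1) ^+ n *: ((-1) ^+ n *: v) = v.
Proof. by rewrite scalerA -exprD addnn -mul2n exprM sqrrN !expr1n scale1r. Qed.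

Lemma lin_mull (A : algType k) (z : A) : linear (fun x => x * z).
Proof. by move=> c u v; rewrite mulrDl -scalerAl. Qed.

Lemma lin_mulr (A : algType k) (z : A) : linear (fun x => z * x).
Proof. by move=> c u v; rewrite mulrDr -scalerAr. Qed.

Record algmap (A B : algType k) (f : A -> B) : Prop := Algmap {
  algmapL : linear f;
  algmapM : monoid_morphism f
}.

Lemma algmap_id (A : algType k) : algmap (@id A).
Proof. by split. Qed.

Lemma algmap_comp (A B C : algType k) (g : B -> C) (f : A -> B) :
  algmap g -> algmap f -> algmap (fun x => g (f x)).
Proof.
move=> [gL [g1 gM]] [fL [f1 fM]]; split; first exact: lin_comp.
by split=> [|x y]; rewrite (f1, fM) (g1, gM).
Qed.

Lemma eq_algmap (A B : algType k) (f g : A -> B) : f =1 g -> algmap f -> algmap g.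
Proof. by move=> /funext ->. Qed.

End AlgebraMaps.

Section TensorLift.
Variable k : fieldType.

(** Although [f] is only meaningful when bilinear, [tlift f] is by definition a sum
    over a representative, so that a linear map passes through it for any [f].
    This spares most side conditions below. *)
Lemma lin_tlift (V W U U' : lmodType k) (h : U -> U') (f : V -> W -> U) x :
  linear h -> h (tlift f x) = tlift (fun v w => h (f v w)) x.
Proof. by move=> hL; rewrite /tlift (lin_sum _ _ _ hL). Qed.

Lemma tlift_tmap (V W V' W' U : lmodType k) (f : V' -> W' -> U)
    (a : V -> V') (b : W -> W') x :
    bilinear_map f -> linear a -> linear b ->
  tlift f (tmap a b x) = tlift (fun v w => f (a v) (b w)) x.
Proof.
move=> fB aL bL; have fL := tlift_linear fB; rewrite /tmap lin_tlift //.
by apply: eq_tlift => v w; rewrite tliftE.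
Qed.

(** The candidate for the map induced on a tensor product by two maps into the
    same algebra: everything below is an instance of it. *)
Definition tmul (V W : lmodType k) (Z : algType k) (f : V -> Z) (g : W -> Z) :
  V ⊗ W -> Z := tlift (fun v w => f v * g w).

Lemma mul_bilinear (V W : lmodType k) (Z : algType k) (f : V -> Z) (g : W -> Z) :
  linear f -> linear g -> bilinear_map (fun v w => f v * g w).
Proof.
move=> fL gL; split=> [w a v v'|v a w w'] /=.
  by rewrite fL mulrDl -scalerAl.
by rewrite gL mulrDr -scalerAr.
Qed.

Lemma tmulE (V W : lmodType k) (Z : algType k) (f : V -> Z) (g : W -> Z) v w :
  linear f -> linear g -> tmul f g (v ⊗t w) = f v * g w.
Proof. by move=> fL gL; rewrite /tmul tliftE //; apply: mul_bilinear. Qed.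

Lemma tmul_linear (V W : lmodType k) (Z : algType k) (f : V -> Z) (g : W -> Z) :
  linear f -> linear g -> linear (tmul f g).
Proof. by move=> fL gL; apply/tlift_linear/mul_bilinear. Qed.

Lemma eq_tmul (V W : lmodType k) (Z : algType k) (f f' : V -> Z) (g g' : W -> Z) x :
  f =1 f' -> g =1 g' -> tmul f g x = tmul f' g' x.
Proof. by move=> ef eg; apply: eq_tlift => v w; rewrite ef eg. Qed.

Lemma algmap_tmul (V W : lmodType k) (Z Z' : algType k) (h : Z -> Z')
    (f : V -> Z) (g : W -> Z) x : algmap h ->
  h (tmul f g x) = tmul (fun v => h (f v)) (fun w => h (g w)) x.
Proof.
move=> [hL [_ hM]]; rewrite /tmul lin_tlift //.
by apply: eq_tlift => v w; rewrite hM.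
Qed.

Lemma tmul_tmap (V W V' W' : lmodType k) (Z : algType k) (f : V' -> Z) (g : W' -> Z)
    (a : V -> V') (b : W -> W') x :
    linear f -> linear g -> linear a -> linear b ->
  tmul f g (tmap a b x) = tmul (fun v => f (a v)) (fun w => g (b w)) x.
Proof. by move=> fL gL aL bL; apply: tlift_tmap => //; apply: mul_bilinear. Qed.

Lemma tmap_comp (V V' V'' W W' W'' : lmodType k) (f : V' -> V'') (g : W' -> W'')
    (a : V -> V') (b : W -> W') x :
    linear f -> linear g -> linear a -> linear b ->
  tmap f g (tmap a b x) = tmap (fun v => f (a v)) (fun w => g (b w)) x.
Proof. by move=> fL gL aL bL; apply: tlift_tmap => //; apply: tmap_bilinear. Qed.

Lemma eq_tmap (V V' W W' : lmodType k) (f f' : V -> V') (g g' : W -> W') x :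
  f =1 f' -> g =1 g' -> tmap f g x = tmap f' g' x.
Proof. by move=> ef eg; apply: eq_tlift => v w; rewrite ef eg. Qed.

Lemma tassoc_bilinear (U V W : lmodType k) :
  bilinear_map (fun (x : U ⊗ V) (w : W) => tlift (fun u v => u ⊗t (v ⊗t w)) x) /\
  forall w : W, bilinear_map (fun (u : U) (v : V) => u ⊗t (v ⊗t w)).
Proof.
have inB (w : W) : bilinear_map (fun (u : U) (v : V) => u ⊗t (v ⊗t w)).
  split=> [v a x x'|x a v v'] /=; first exact: tensPl.
  by rewrite tensPl tensPr.
split=> //; split=> [w a x x'|x a w w'] /=.
  exact: (tlift_linear (inB w)).
rewrite -tlift_fun_linear; apply: eq_tlift => u v.
by rewrite !tensPr.
Qed.

Lemma tassocE (U V W : lmodType k) (u : U) (v : V) (w : W) :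
  tassoc ((u ⊗t v) ⊗t w) = u ⊗t (v ⊗t w).
Proof.
have [outB inB] := tassoc_bilinear U V W.
by rewrite /tassoc (tliftE _ _ outB) (tliftE _ _ (inB w)).
Qed.

Lemma tassoc_linear (U V W : lmodType k) : linear (@tassoc k U V W).
Proof. exact: (tlift_linear (tassoc_bilinear U V W).1). Qed.

Lemma tassoc_tmap (U V W U' V' W' : lmodType k)
    (f : U -> U') (g : V -> V') (h : W -> W') x :
    linear f -> linear g -> linear h ->
  tassoc (tmap (tmap f g) h x) = tmap f (tmap g h) (tassoc x).
Proof.
move=> fL gL hL; have fgL := tmap_linear fL gL; have ghL := tmap_linear gL hL.
have aL := @tassoc_linear; move: x; apply: linear_tens_eq.
- exact: (lin_comp (aL _ _ _) (tmap_linear fgL hL)).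
- exact: (lin_comp (tmap_linear fL ghL) (aL _ _ _)).
move=> x w; move: x; apply: linear_tens_eq => [||u v].
- exact: lin_comp (lin_comp (aL _ _ _) (tmap_linear fgL hL))
    ((tens_bilinear _ _).1 w).
- exact: lin_comp (lin_comp (tmap_linear fL ghL) (aL _ _ _))
    ((tens_bilinear _ _).1 w).
by rewrite !tmapE // !tassocE !tmapE.
Qed.

End TensorLift.

(** * The super tensor product and its universal property *)

Section Super.
Variable k : fieldType.
Implicit Types X Y Z : gradedAlgType k.

Lemma homogZ X n (c : k) (x : X) : homog n x -> homog n (c *: x).
Proof. by rewrite /homog (linZ (gcomp_linear n)) => ->. Qed.

Lemma homogD X n (x y : X) : homog n x -> homog n y -> homog n (x + y).
Proof. by rewrite /homog (linD (gcomp_linear n)) => -> ->. Qed.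

Lemma homog_sum X n I (r : seq I) (F : I -> X) :
  (forall i, homog n (F i)) -> homog n (\sum_(i <- r) F i).
Proof.
move=> hF; elim/big_ind: _ => // [|x y]; first exact: homog0.
exact: homogD.
Qed.

Lemma homog_tens X Y m n (x : X) (y : Y) : homog m x -> homog n y ->
  homog (m + n) (x ⊗t y : X ⊗s Y).
Proof. by move=> hx hy; rewrite /homog [LHS](stens_compE _ hx hy) eqxx. Qed.

(** Being homogeneous of total degree [n] does not say that an element is
    presented as a sum of pure tensors of bidegree summing to [n]; applying the
    projection onto degree [n] to an arbitrary presentation gives one that is. *)
Lemma stens_homog_ind X Y n (P : X ⊗s Y -> Prop) :
    P 0 -> (forall x y, P x -> P y -> P (x + y)) ->
    (forall p q x y, (p + q)%N = n -> homog p x -> homog q y ->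
       P (x ⊗t y : X ⊗s Y)) ->
  forall z, homog n z -> P z.
Proof.
move=> P0 PD Pt z <-; have cL := @stens_comp_linear k X Y n.
suff: P (stens_comp n z) by [].
move: z; apply: tens_ind => [|x y|x y hx hy].
- by rewrite (lin0 cL).
- have hl y' : linear (fun x' : X => stens_comp n (x' ⊗t y' : X ⊗s Y)).
    exact: (lin_comp (h := tens^~ y') cL ((tens_bilinear X Y).1 y')).
  have hr x' : linear (fun y' : Y => stens_comp n (x' ⊗t y' : X ⊗s Y)).
    exact: (lin_comp (h := tens x') cL ((tens_bilinear X Y).2 x')).
  elim/homog_ind: x => [|p x hx|x x' Px Px'].
  + by rewrite (lin0 (hl y)).
  + elim/homog_ind: y => [|q y hy|y y' Py Py'].
    * by rewrite (lin0 (hr x)).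
    * rewrite (stens_compE _ hx hy); case: eqP => // pq; exact: Pt (esym pq) hx hy.
    * by rewrite (linD (hr x)); apply: PD.
  + by rewrite (linD (hl y)); apply: PD.
- by rewrite (linD cL); apply: PD.
Qed.

Definition sinl X Y (x : X) : X ⊗s Y := x ⊗t 1.
Definition sinr X Y (y : Y) : X ⊗s Y := 1 ⊗t y.

Lemma sinl_linear X Y : linear (@sinl X Y).
Proof. exact: (tens_bilinear X Y).1. Qed.

Lemma sinr_linear X Y : linear (@sinr X Y).
Proof. exact: (tens_bilinear X Y).2. Qed.

Lemma sinl_tens X Y (x a : X) (b : Y) :
  sinl Y x * (a ⊗t b : X ⊗s Y) = (x * a) ⊗t b.
Proof.
move: a; apply: linear_homog_eq => [||n a ha].
- by move=> c u v; rewrite tensPl mulrDr -scalerAr.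
- by move=> c u v; rewrite mulrDr -scalerAr tensPl.
by rewrite [LHS](stens_mulE _ _ (homog1 Y) ha) mul0n scale1r mul1r.
Qed.

Lemma tens_sinr X Y (a : X) (b y : Y) :
  (a ⊗t b : X ⊗s Y) * sinr X y = a ⊗t (b * y).
Proof.
move: b; apply: linear_homog_eq => [||n b hb].
- by move=> c u v; rewrite tensPr mulrDl -scalerAl.
- by move=> c u v; rewrite mulrDl -scalerAl tensPr.
by rewrite [LHS](stens_mulE _ _ hb (homog1 X)) muln0 scale1r mulr1.
Qed.

(** Reading a pure tensor as a product of the two inclusions is what turns
    identities of tensors into identities in an algebra. *)
Lemma sinl_sinr X Y (x : X) (y : Y) : sinl Y x * sinr X y = x ⊗t y.
Proof. by rewrite sinl_tens mulr1. Qed.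

Lemma sinl_algmap X Y : algmap (@sinl X Y).
Proof.
by split; [exact: sinl_linear|split=> // x y; rewrite sinl_tens].
Qed.

Lemma sinr_algmap X Y : algmap (@sinr X Y).
Proof.
by split; [exact: sinr_linear|split=> // x y; rewrite tens_sinr].
Qed.

Lemma sinl_homog X Y n x : homog n x -> homog n (@sinl X Y x).
Proof. by move=> hx; rewrite -[n]addn0; apply: homog_tens hx (homog1 Y). Qed.

Lemma sinr_homog X Y n y : homog n y -> homog n (@sinr X Y y).
Proof. by move=> hy; rewrite -[n]add0n; apply: homog_tens (homog1 X) hy. Qed.

(** Super-commutation of the images of two maps, with the degrees measured in
    their sources; the common target may be ungraded. *)
Definition scommute X Y (Z : algType k) (f : X -> Z) (g : Y -> Z) : Prop :=
  forall m n x y, homog m x -> homog n y -> f x * g y = (-1) ^+ (m * n) *: (g y * f x).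

Lemma scommute_sym X Y (Z : algType k) (f : X -> Z) (g : Y -> Z) :
  scommute f g -> scommute g f.
Proof.
move=> fg m n x y hx hy; by rewrite (fg n m y x) // [(n * m)%N]mulnC signZK.
Qed.

Lemma scommute_comp X X' Y (Z : algType k) (f : X -> Z) (g : Y -> Z) (h : X' -> X) :
    (forall n x, homog n x -> homog n (h x)) ->
  scommute f g -> scommute (fun x => f (h x)) g.
Proof. by move=> hh fg m n x y hx; apply: fg; apply: hh. Qed.

Lemma scommute_post X Y (Z Z' : algType k) (f : X -> Z) (g : Y -> Z) (h : Z -> Z') :
  algmap h -> scommute f g -> scommute (fun x => h (f x)) (fun y => h (g y)).
Proof.
move=> [hL [_ hM]] fg m n x y hx hy; rewrite -!hM (fg m n) //.
by rewrite (linZ hL).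
Qed.

Lemma scommute_tmul X Y X' (Z : algType k) (f : X -> Z) (g : Y -> Z) (h : X' -> Z) :
    linear f -> linear g -> scommute f h -> scommute g h ->
  scommute (tmul f g : X ⊗s Y -> Z) h.
Proof.
move=> fL gL fh gh n r z w hz hw; move: z hz.
have tL := tmul_linear fL gL.
apply: stens_homog_ind => [|x y Px Py|p q x y pq hx hy].
- by rewrite (lin0 tL) mul0r mulr0 scaler0.
- by rewrite (linD tL) mulrDl mulrDr scalerDr Px Py.
rewrite tmulE // -mulrA (gh _ _ _ _ hy hw) -scalerAr [f x * (h w * _)]mulrA.
rewrite (fh _ _ _ _ hx hw) -scalerAl scalerA -mulrA -exprD -mulnDl addnC.
by rewrite pq.
Qed.

Lemma scommute_sinl_sinr X Y : scommute (@sinl X Y) (@sinr X Y).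
Proof.
move=> m n x y hx hy; rewrite sinl_sinr [X in _ *: X](stens_mulE _ _ hy hx).
by rewrite [(n * m)%N]mulnC signZK mul1r mulr1.
Qed.

(** In f(a) g(b) f(c) g(d), moving g(b) past f(c) produces exactly the sign of the
    product (a ⊗ b)(c ⊗ d). *)
Lemma tmul_algmap X Y (Z : algType k) (f : X -> Z) (g : Y -> Z) :
  algmap f -> algmap g -> scommute f g -> algmap (tmul f g : X ⊗s Y -> Z).
Proof.
move=> [fL [f1 fM]] [gL [g1 gM]] fg; have tL := tmul_linear fL gL.
split=> //; split=> [|x y]; first by rewrite [LHS]tmulE // f1 g1 mulr1.
move: x; apply: stens_linear_eq => [||m n a b ha hb].
- exact: (lin_comp tL (lin_mull (y : X ⊗s Y))).
- exact: (lin_comp (lin_mull _) tL).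
move: y; apply: stens_linear_eq => [||p q c d hc hd].
- exact: (lin_comp tL (lin_mulr (a ⊗t b : X ⊗s Y))).
- exact: (lin_comp (lin_mulr _) tL).
rewrite [X in tmul f g X](stens_mulE _ _ hb hc) (linZ tL) !tmulE // fM gM.
rewrite -!mulrA [f c * (g b * _)]mulrA (fg _ _ _ _ hc hb) -!scalerAl -!scalerAr.
by rewrite [(p * n)%N]mulnC signZK !mulrA.
Qed.

Lemma tmul_homog X Y Z (f : X -> Z) (g : Y -> Z) :
    linear f -> linear g ->
    (forall n x, homog n x -> homog n (f x)) ->
    (forall n x, homog n x -> homog n (g x)) ->
  forall n (x : X ⊗s Y), homog n x -> homog n (tmul f g x).
Proof.
move=> fL gL fh gh n; apply: stens_homog_ind => [|x y|p q x y <- hx hy].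
- by rewrite (lin0 (tmul_linear fL gL)); apply: homog0.
- by rewrite (linD (tmul_linear fL gL)); apply: homogD.
by rewrite tmulE //; apply: homogM; [apply: fh|apply: gh].
Qed.

End Super.

(** * Differential graded algebras *)

Section DGA.
Variable k : fieldType.
Implicit Types X Y Z : gradedAlgType k.

Record is_dga X (d : X -> X) : Prop := {
  dga_linear : linear d;
  dga_degree : forall n x, homog n x -> homog n.+1 (d x);
  dga_square : forall x, d (d x) = 0;
  dga_leibniz : forall n x y, homog n x ->
    d (x * y) = d x * y + (-1) ^+ n *: (x * d y)
}.

Record dgmap X Z (dX : X -> X) (dZ : Z -> Z) (f : X -> Z) : Prop := {
  dgmap_alg : algmap f;
  dgmap_homog : forall n x, homog n x -> homog n (f x);
  dgmap_d : forall x, f (dX x) = dZ (f x)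
}.

Lemma dga1 X (d : X -> X) : is_dga d -> d 1 = 0.
Proof.
move=> dX; have := dga_leibniz dX 1 (homog1 X).
rewrite mulr1 mul1r mulr1 expr0 scale1r => /eqP.
by rewrite -subr_eq0 opprD addrA subrr add0r oppr_eq0 => /eqP.
Qed.

Lemma gcomp0M X : {morph (@gcomp k X 0) : x y / x * y}.
Proof.
have cL := @gcomp_linear k X 0.
move=> x y; move: x; apply: linear_homog_eq => [||m x hx].
- exact: (lin_comp cL (lin_mull y)).
- exact: (lin_comp (lin_mull _) cL).
move: y; apply: linear_homog_eq => [||n y hy].
- exact: (lin_comp cL (lin_mulr x)).
- exact: (lin_comp (lin_mulr _) cL).
rewrite (homog_comp _ (homogM hx hy)) (homog_comp _ hx) (homog_comp _ hy).
by case: m {hx} => [|m]; case: n {hy} => [|n]; rewrite ?(mul0r, mulr0).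
Qed.

Lemma stens_diff_linear X Y (dX : X -> X) (dY : Y -> Y) :
  linear dX -> linear dY -> linear (stens_diff dX dY).
Proof.
move=> dXL dYL; apply: tlift_linear.
split=> [v a u u'|u a v v'] /=.
  by rewrite dXL ginvol_linear !tensPl scalerDr addrACA.
by rewrite dYL !tensPr scalerDr addrACA.
Qed.

Lemma eq_sign m n : odd m = odd n -> (-1) ^+ m = (-1) ^+ n :> k.
Proof. by move=> mn; rewrite -signr_odd mn signr_odd. Qed.

(** The two mixed terms of d(d(a ⊗ b)) cancel because d raises the degree of a by
    one. *)
Lemma stens_dga X Y (dX : X -> X) (dY : Y -> Y) :
  is_dga dX -> is_dga dY -> is_dga (stens_diff dX dY).
Proof.
move=> HX HY; have XL := dga_linear HX; have YL := dga_linear HY.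
have dL : linear (stens_diff dX dY) := stens_diff_linear XL YL.
have dE m a b := stens_diffE (n := m) (x := a) b XL YL.
have dh n (z : X ⊗s Y) : homog n z -> homog n.+1 (stens_diff dX dY z).
  move: z; apply: stens_homog_ind => [|x y Px Py|p q x y pq hx hy].
  - by rewrite (lin0 dL); apply: homog0.
  - by rewrite (linD dL); apply: homogD.
  rewrite (dE _ _ _ hx) -pq; apply: homogD.
    by rewrite -addSn; apply: homog_tens hy; apply: dga_degree.
  by apply: homogZ; rewrite -addnS; apply: homog_tens hx _; apply: dga_degree.
split=> // [z|n z w hz].
  move: z.
  apply: (stens_linear_eq (U := X ⊗s Y) (g := fun _ => 0)) => [||m n a b ha hb].
  - exact: (lin_comp dL dL).
  - by move=> c u v; rewrite scaler0 addr0.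
  rewrite (dE _ _ _ ha) (linD dL) (linZ dL).
  rewrite (dE _ _ _ (dga_degree HX ha)) (dE _ _ _ ha).
  rewrite !dga_square // tens0l add0r tens0r scaler0 addr0.
  by rewrite exprS mulN1r scaleNr addNr.
move: z hz; apply: stens_homog_ind => [|x y Px Py|m q a b mq ha hb].
- by rewrite !(mul0r, lin0 dL) scaler0 addr0.
- by rewrite (linD dL) !mulrDl (linD dL) Px Py scalerDr addrACA.
move: w; apply: (stens_linear_eq (U := X ⊗s Y)) => [||r s c e hc he].
- exact: (lin_comp dL (lin_mulr (a ⊗t b : X ⊗s Y))).
- move=> c u v; rewrite !(mulrDr, dL) -!scalerAr scalerDr scalerDr !scalerA.
  by rewrite [_ * c]mulrC addrACA.
rewrite [X in stens_diff _ _ X](stens_mulE _ _ hb hc) (linZ dL).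
rewrite (dE _ _ _ (homogM ha hc)) (dE _ _ _ ha) (dE _ _ _ hc).
rewrite !(mulrDl, mulrDr) -!(scalerAl, scalerAr).
rewrite [(_ ⊗t _ : X ⊗s Y) * _](stens_mulE _ _ hb hc).
rewrite [(_ ⊗t dY _ : X ⊗s Y) * _](stens_mulE _ _ (dga_degree HY hb) hc).
rewrite [(_ ⊗t _ : X ⊗s Y) * (dX _ ⊗t _)](stens_mulE _ _ hb (dga_degree HX hc)).
rewrite [(_ ⊗t _ : X ⊗s Y) * (_ ⊗t dY _)](stens_mulE _ _ hb hc).
rewrite (dga_leibniz HX _ ha) (dga_leibniz HY _ hb) -mq.
rewrite (linD (h := tens^~ _) ((tens_bilinear X Y).1 _)).
rewrite (linD (h := tens _) ((tens_bilinear X Y).2 _)).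
rewrite (linZ (h := tens^~ _) ((tens_bilinear X Y).1 _)).
rewrite (linZ (h := tens _) ((tens_bilinear X Y).2 _)).
rewrite !scalerDr !scalerA -!exprD -!addrA; congr (_ + _).
rewrite addrCA; congr (_ + (_ + _)).
- by rewrite mulSn; congr ((-1) ^+ _ *: _); rewrite addnC -addnA [(r + _)%N]addnC addnA.
- congr (_ *: _); apply: eq_sign; rewrite ?mulnS !oddD.
  by move: (odd m) (odd q) (odd (q * r)) => [] [] [].
congr (_ *: _); apply: eq_sign; rewrite ?mulnS !oddD.
by move: (odd m) (odd q) (odd r) (odd (q * r)) => [] [] [] [].
Qed.

Lemma dgmap_id X (d : X -> X) : dgmap d d id.
Proof. by split=> //; apply: algmap_id. Qed.

Lemma dgmap_comp X Y Z dX dY dZ (g : Y -> Z) (f : X -> Y) :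
  dgmap dY dZ g -> dgmap dX dY f -> dgmap dX dZ (fun x => g (f x)).
Proof.
move=> [ga gh gd] [fa fh fd]; split=> [|n x hx|x].
- exact: algmap_comp.
- exact/gh/fh.
- by rewrite fd gd.
Qed.

Lemma eq_dgmap X Z dX dZ (f g : X -> Z) : f =1 g -> dgmap dX dZ f -> dgmap dX dZ g.
Proof. by move=> /funext ->. Qed.

Lemma sinl_dgmap X Y (dX : X -> X) (dY : Y -> Y) : is_dga dX -> is_dga dY ->
  dgmap dX (stens_diff dX dY) (@sinl k X Y).
Proof.
move=> HX HY; split; [exact: sinl_algmap|exact: sinl_homog|].
apply: linear_homog_eq => [||n x hx].
- exact: (lin_comp (@sinl_linear k X Y) (dga_linear HX)).
- exact: (lin_comp (stens_diff_linear (dga_linear HX) (dga_linear HY))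
    (@sinl_linear k X Y)).
rewrite (stens_diffE _ (dga_linear HX) (dga_linear HY) hx).
by rewrite (dga1 HY) tens0r scaler0 addr0.
Qed.

Lemma sinr_dgmap X Y (dX : X -> X) (dY : Y -> Y) : is_dga dX -> is_dga dY ->
  dgmap dY (stens_diff dX dY) (@sinr k X Y).
Proof.
move=> HX HY; split; [exact: sinr_algmap|exact: sinr_homog|move=> y].
rewrite (stens_diffE _ (dga_linear HX) (dga_linear HY) (homog1 X)).
by rewrite (dga1 HX) tens0l add0r scale1r.
Qed.

Lemma tmul_dgmap X Y Z (dX : X -> X) (dY : Y -> Y) (dZ : Z -> Z)
    (f : X -> Z) (g : Y -> Z) :
    is_dga dX -> is_dga dY -> is_dga dZ ->
    dgmap dX dZ f -> dgmap dY dZ g -> scommute f g ->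
  dgmap (stens_diff dX dY) dZ (tmul f g : X ⊗s Y -> Z).
Proof.
move=> HX HY HZ [fa fh fd] [ga gh gd] fg.
have [fL _] := fa; have [gL _] := ga; have tL := tmul_linear fL gL.
have XL := dga_linear HX; have YL := dga_linear HY.
split; [exact: tmul_algmap|exact: tmul_homog|].
apply: (stens_linear_eq (U := Z)) => [||m n x y hx hy].
- exact: (lin_comp tL (stens_diff_linear XL YL)).
- exact: (lin_comp (dga_linear HZ) tL).
rewrite (stens_diffE _ XL YL hx) (linD tL) (linZ tL) !tmulE //.
by rewrite (dga_leibniz HZ _ (fh _ _ hx)) fd gd.
Qed.

Lemma tmap_tmul X Y X' Y' (f : X -> X') (g : Y -> Y') (z : X ⊗s Y) :
  tmap f g z = tmul (fun x => sinl Y' (f x)) (fun y => sinr X' (g y)) z.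
Proof. by apply: eq_tlift => x y; rewrite sinl_sinr. Qed.

Lemma tmap_algmap X Y X' Y' (f : X -> X') (g : Y -> Y') :
    algmap f -> algmap g ->
    (forall n x, homog n x -> homog n (f x)) ->
    (forall n x, homog n x -> homog n (g x)) ->
  algmap (tmap f g : X ⊗s Y -> X' ⊗s Y').
Proof.
move=> fa ga fh gh; 
apply: (eq_algmap (A := X ⊗s Y) (B := X' ⊗s Y') (fun z => esym (tmap_tmul f g z))).
apply: tmul_algmap.
- exact: algmap_comp (sinl_algmap _ _) fa.
- exact: algmap_comp (sinr_algmap _ _) ga.
apply: (scommute_comp fh); apply/scommute_sym/(scommute_comp gh)/scommute_sym.
exact: scommute_sinl_sinr.
Qed.

Lemma tmap_dgmap X Y X' Y' dX dY dX' dY' (f : X -> X') (g : Y -> Y') :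
    is_dga dX -> is_dga dY -> is_dga dX' -> is_dga dY' ->
    dgmap dX dX' f -> dgmap dY dY' g ->
  dgmap (stens_diff dX dY) (stens_diff dX' dY') (tmap f g : X ⊗s Y -> X' ⊗s Y').
Proof.
move=> HX HY HX' HY' df dg; 
apply: (eq_dgmap (X := X ⊗s Y) (Z := X' ⊗s Y') (fun z => esym (tmap_tmul f g z))).
apply: tmul_dgmap => //; first exact: stens_dga.
- exact: dgmap_comp (sinl_dgmap HX' HY') df.
- exact: dgmap_comp (sinr_dgmap HX' HY') dg.
apply: (scommute_comp (dgmap_homog df)).
apply/scommute_sym/(scommute_comp (dgmap_homog dg))/scommute_sym.
exact: scommute_sinl_sinr.
Qed.

(** The associator is the map induced by the three inclusions, hence a map of
    differential graded algebras. *)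
Lemma tassoc_tmul X Y Z (z : (X ⊗s Y) ⊗s Z) :
  tassoc z =
  tmul (tmul (@sinl k X (Y ⊗s Z)) (fun y => sinr X (sinl Z y)) : X ⊗s Y -> _)
    (fun z => sinr X (sinr Y z)) z.
Proof.
apply: eq_tlift => x w; rewrite /tmul (lin_tlift _ _ (lin_mull _)).
apply: eq_tlift => u v; rewrite sinl_sinr.
by rewrite [RHS](tens_sinr u (sinl Z v)) sinl_sinr.
Qed.

Lemma tassoc_dgmap X Y Z dX dY dZ : is_dga dX -> is_dga dY -> is_dga dZ ->
  dgmap (stens_diff (stens_diff dX dY) dZ) (stens_diff dX (stens_diff dY dZ))
    (@tassoc k X Y Z : (X ⊗s Y) ⊗s Z -> X ⊗s (Y ⊗s Z)).
Proof.
move=> HX HY HZ; apply: (eq_dgmap (X := (X ⊗s Y) ⊗s Z) (Z := X ⊗s (Y ⊗s Z))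
  (fun z => esym (tassoc_tmul z))).
have HYZ := stens_dga HY HZ.
have cXYZ := @scommute_sinl_sinr k X (Y ⊗s Z).
have d1 := sinl_dgmap HX HYZ.
have d2 := dgmap_comp (sinr_dgmap HX HYZ) (sinl_dgmap HY HZ).
have d3 := dgmap_comp (sinr_dgmap HX HYZ) (sinr_dgmap HY HZ).
have c12 : scommute (@sinl k X (Y ⊗s Z)) (fun y => sinr X (sinl Z y)).
  exact/scommute_sym/(scommute_comp (@sinl_homog k Y Z))/scommute_sym.
have c13 : scommute (@sinl k X (Y ⊗s Z)) (fun z => sinr X (sinr Y z)).
  exact/scommute_sym/(scommute_comp (@sinr_homog k Y Z))/scommute_sym.
have c23 : scommute (fun y => sinr X (sinl Z y)) (fun z => sinr X (sinr Y z)).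
  exact: scommute_post (sinr_algmap X _) (@scommute_sinl_sinr k Y Z).
apply: tmul_dgmap => //; [exact: stens_dga|exact: stens_dga| |].
  by apply: tmul_dgmap => //; apply: stens_dga.
apply: scommute_tmul => //; first exact: sinl_linear.
exact: (lin_comp (@sinr_linear k X _) (@sinl_linear k Y Z)).
Qed.

Lemma tmul_sinl (U V : gradedAlgType k) (Z : algType k) (f : U -> Z) (g : V -> Z) u :
  algmap f -> algmap g -> tmul f g (sinl V u) = f u.
Proof. by move=> [fL _] [gL [g1 _]]; rewrite /sinl tmulE // g1 mulr1. Qed.

Lemma tmul_sinr (U V : gradedAlgType k) (Z : algType k) (f : U -> Z) (g : V -> Z) v :
  algmap f -> algmap g -> tmul f g (sinr U v) = g v.
Proof. by move=> [fL [f1 _]] [gL _]; rewrite /sinr tmulE // f1 mul1r. Qed.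

Lemma tmul_sinl_sinr X Y (z : X ⊗s Y) :
  tmul (@sinl k X Y) (@sinr k X Y) z = z.
Proof.
by rewrite [RHS]tens_sum; apply: eq_bigr => p _; apply: sinl_sinr.
Qed.

Lemma algmap_stens_eq X Y (Z : algType k) (f g : X ⊗s Y -> Z) :
    algmap f -> algmap g ->
    (forall x, f (sinl Y x) = g (sinl Y x)) ->
    (forall y, f (sinr X y) = g (sinr X y)) -> f =1 g.
Proof.
move=> [fL [_ fM]] [gL [_ gM]] fgl fgr; apply: linear_tens_eq => // x y.
by rewrite -sinl_sinr fM gM fgl fgr.
Qed.

End DGA.

(** * Generation of exterior algebras by degree 0 *)

Section Exterior.
Variables (k : fieldType) (A : algType k) (X : gradedAlgType k).
Variables (iota : A -> X) (d : X -> X).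
Hypothesis HX : is_exterior_algebra iota d.

Lemma ext_dga : is_dga d.
Proof. by case: HX. Qed.

Lemma ext_incl_algmap : algmap iota.
Proof. by split; [exact: ext_incl_linear HX|exact: ext_incl_mul HX]. Qed.

Lemma homog_incl a : homog 0 (iota a).
Proof. by apply/(ext_degree0 HX); exists a. Qed.

Lemma ext_subalg_ind (P : X -> Prop) :
    P 1 -> (forall c x y, P x -> P y -> P (c *: x + y)) ->
    (forall x y, P x -> P y -> P (x * y)) ->
    (forall a, P (iota a)) -> (forall x, homog 1 x -> P x) ->
  forall x, P x.
Proof.
move=> P1 PL PM Pi P1h x.
have Sc : subalg_closed [pred x | `[< P x >]].
  split=> [|c u v|u v]; rewrite ?inE.
  - exact/asboolP.
  - by move=> /asboolP Pu /asboolP Pv; apply/asboolP/PL.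
  - by move=> /asboolP Pu /asboolP Pv; apply/asboolP/PM.
suff: x \in [pred x | `[< P x >]] by rewrite inE => /asboolP.
apply: (ext_generated HX Sc) => [a|y hy]; rewrite inE; apply/asboolP.
  exact: Pi.
exact: P1h.
Qed.

Lemma ext_gen_ind (P : X -> Prop) :
    P 1 -> (forall c x y, P x -> P y -> P (c *: x + y)) ->
    (forall x y, P x -> P y -> P (x * y)) ->
    (forall a, P (iota a)) -> (forall a, P (d (iota a))) ->
  forall x, P x.
Proof.
move=> P1 PL PM Pi Pd; apply: ext_subalg_ind => // x /(ext_degree1 HX) [s ->].
have P0 : P 0 by rewrite -(addNr (1 : X)) -scaleN1r; apply: PL.
elim/big_ind: _ => // [u v Pu Pv|p _]; last exact: PM.
by rewrite -[u]scale1r; apply: PL.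
Qed.

(** Compatibility with the differentials propagates agreement from degree 0 to the
    generators d(iota a). *)
Lemma ext_map_eq (Z : algType k) (dZ : Z -> Z) (f g : X -> Z) :
    algmap f -> algmap g ->
    (forall x, f (d x) = dZ (f x)) -> (forall x, g (d x) = dZ (g x)) ->
    (forall a, f (iota a) = g (iota a)) -> f =1 g.
Proof.
move=> [fL [f1 fM]] [gL [g1 gM]] fd gd fg.
apply: ext_gen_ind => [|c x y ex ey|x y ex ey|//|a].
- by rewrite f1 g1.
- by rewrite fL gL ex ey.
- by rewrite fM gM ex ey.
- by rewrite fd gd fg.
Qed.

Lemma ext_dgmap_eq (Z : gradedAlgType k) (dZ : Z -> Z) (f g : X -> Z) :
  dgmap d dZ f -> dgmap d dZ g -> (forall a, f (iota a) = g (iota a)) -> f =1 g.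
Proof. by move=> [fa _ fd] [ga _ gd]; apply: (ext_map_eq (dZ := dZ)). Qed.

(** The projection onto degree 0 is multiplicative because degrees are
    nonnegative: degree 0 components of a product come from degree 0 factors only. *)
Lemma ext_retraction : exists rho : X -> A,
  [/\ algmap rho, forall x, iota (rho x) = gcomp 0 x & cancel iota rho].
Proof.
have [iL [i1 iM]] := ext_incl_algmap; have iI := ext_incl_inj HX.
have ex x : exists a, iota a = gcomp 0 x.
  by have [a ->] := (ext_degree0 HX _).1 (gcomp_homog 0 x); exists a.
have [rho rhoE] := choice ex.
have rhoK : cancel iota rho by move=> a; apply: iI; rewrite rhoE homog_incl.
exists rho; split=> //; split=> [c x y|].
  by apply: iI; rewrite iL !rhoE gcomp_linear.
split=> [|x y]; first by apply: iI; rewrite rhoE gcomp1 i1.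
apply: iI; rewrite iM !rhoE; exact: gcomp0M.
Qed.
End Exterior.

(** * Parity and counits *)

Section Parity.
Variable k : fieldType.
Implicit Types X Y Z : gradedAlgType k.

Lemma homog_parity X n (x : X) : homog n x -> has_parity (odd n) x.
Proof.
move=> hx m; rewrite (homog_comp _ hx); case: (m =P n) => // ->.
by rewrite eqxx.
Qed.

Lemma parity0 X b : has_parity b (0 : X).
Proof. by move=> n _; apply: lin0 (gcomp_linear n). Qed.

Lemma parityD X b (x y : X) : has_parity b x -> has_parity b y -> has_parity b (x + y).
Proof.
by move=> hx hy n nb; rewrite (linD (gcomp_linear n)) hx // hy // addr0.
Qed.

Lemma parity_ind X b (P : X -> Prop) :
    P 0 -> (forall x y, P x -> P y -> P (x + y)) ->
    (forall n x, odd n = b -> homog n x -> P x) ->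
  forall x, has_parity b x -> P x.
Proof.
move=> P0 PD Ph x hx; rewrite (gcomp_sumE (leqnn (gbound x))).
elim/big_ind: _ => // n _; have [nb|nb] := eqVneq (odd n) b.
  exact: Ph nb (gcomp_homog n x).
by rewrite hx.
Qed.

Lemma parityM X b c (x y : X) :
  has_parity b x -> has_parity c y -> has_parity (b (+) c) (x * y).
Proof.
move=> hx hy; move: x hx; apply: parity_ind => [|x x' Px Px'|m x mb hx].
- by rewrite mul0r; apply: parity0.
- by rewrite mulrDl; apply: parityD.
move: y hy; apply: parity_ind => [|y y' Py Py'|n y nc hy].
- by rewrite mulr0; apply: parity0.
- by rewrite mulrDr; apply: parityD.
by rewrite -mb -nc -oddD; apply/homog_parity/homogM.
Qed.

Lemma homog_parity_preserving X Z (f : X -> Z) : linear f ->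
  (forall n x, homog n x -> homog n (f x)) -> parity_preserving f.
Proof.
move=> fL fh b; apply: parity_ind => [|x y Px Py|n x <- hx].
- by rewrite (lin0 fL); apply: parity0.
- by rewrite (linD fL); apply: parityD.
exact/homog_parity/fh.
Qed.

Lemma tmul_parity X Y Z (f : X -> Z) (g : Y -> Z) :
    linear f -> linear g -> parity_preserving f -> parity_preserving g ->
  parity_preserving (tmul f g : X ⊗s Y -> Z).
Proof.
move=> fL gL fp gp b; have tL := tmul_linear fL gL.
apply: parity_ind => [|x y Px Py|n z <-].
- by rewrite (lin0 tL); apply: parity0.
- by rewrite (linD tL); apply: parityD.
move: z; apply: stens_homog_ind => [|x y Px Py|p q x y <- hx hy].
- by rewrite (lin0 tL); apply: parity0.
- by rewrite (linD tL); apply: parityD.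
by rewrite tmulE // oddD; apply: parityM; [apply/fp/homog_parity|apply/gp/homog_parity].
Qed.
End Parity.

Section Counit.
Variable k : fieldType.

Definition scalar_map (V : lmodType k) (B : algType k) (eps : V -> k) : V -> B :=
  fun x => eps x *: 1.

Lemma scalar_map_linear (V : lmodType k) (B : algType k) (eps : V -> k) :
  scalar eps -> linear (scalar_map B eps).
Proof. by move=> eL c x y; rewrite /scalar_map eL scalerDl scalerA. Qed.

Lemma scalar_map_algmap (A B : algType k) (eps : A -> k) :
  scalar eps -> monoid_morphism eps -> algmap (scalar_map B eps).
Proof.
move=> eL [e1 eM]; split; first exact: scalar_map_linear.
split=> [|x y]; first by rewrite /scalar_map e1 scale1r.
by rewrite /scalar_map eM -scalerAl mul1r scalerA.
Qed.

Lemma algmap_scalar_map (U : lmodType k) (Z Z' : algType k) (f : Z -> Z') (e : U -> k) u :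
  algmap f -> f (scalar_map Z e u) = scalar_map Z' e u.
Proof. by move=> [fL [f1 _]]; rewrite /scalar_map (linZ fL) f1. Qed.

Variables (A : algType k) (X : gradedAlgType k) (iota : A -> X) (d : X -> X).
Variable eps : X -> k.
Hypothesis HX : is_exterior_algebra iota d.
Hypothesis eL : scalar eps.
Hypothesis eM : monoid_morphism eps.
Hypothesis eodd : forall x, has_parity true x -> eps x = 0.

(** Vanishing on odd elements, in particular in degree 1, is enough for the counit
    to vanish in every positive degree: both sides are algebra maps, and the
    exterior algebra is generated in degrees 0 and 1. *)
Lemma counit_gcomp0 x : eps (gcomp 0 x) = eps x.
Proof.
have cL := @gcomp_linear k X 0; have [e1 eMul] := eM.
move: x; apply: (ext_subalg_ind HX) => [|c x y ex ey|x y ex ey|a|x hx].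
- by rewrite gcomp1.
- by rewrite cL !eL ex ey.
- by rewrite gcomp0M !eMul ex ey.
- by rewrite (homog_incl HX).
rewrite (homog_comp _ hx) /= (lin0 (V := k^o) eL).
by rewrite eodd //; apply: homog_parity hx.
Qed.

Lemma counit_pos n x : (0 < n)%N -> homog n x -> eps x = 0.
Proof.
move=> n0 hx; rewrite -counit_gcomp0 (homog_comp _ hx) eq_sym gtn_eqF //.
exact: (lin0 (V := k^o) eL).
Qed.

Lemma counit_d x : eps (d x) = 0.
Proof.
have dL := ext_d_linear HX.
move: x; apply: (linear_homog_eq (V := k^o) (f := fun x => eps (d x)) (g := fun _ => 0)).
- exact: (lin_comp (W := k^o) eL dL).
- by move=> c u v; rewrite scaler0 addr0.
by move=> n x hx; apply: (counit_pos (n := n.+1)) => //; apply: ext_d_degree HX _ _ hx.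
Qed.

Lemma counit_dgmap (Z : gradedAlgType k) (dZ : Z -> Z) : is_dga dZ ->
  dgmap d dZ (scalar_map Z eps).
Proof.
move=> HZ; split=> [|n x hx|x]; first exact: scalar_map_algmap.
  have [->|n0] := posnP n; first by apply: homogZ; apply: homog1.
  by rewrite /scalar_map (counit_pos n0 hx) scale0r; apply: homog0.
by rewrite /scalar_map counit_d scale0r (linZ (dga_linear HZ)) (dga1 HZ) scaler0.
Qed.

Lemma counit_scommute (Y : gradedAlgType k) (Z : algType k) (g : Y -> Z) :
  scommute (scalar_map Z eps) g.
Proof.
move=> m n x y hx hy; have [m0|m0] := posnP m.
  by rewrite m0 mul0n scale1r /scalar_map -scalerAl -scalerAr mul1r mulr1.
by rewrite /scalar_map (counit_pos m0 hx) scale0r mul0r mulr0 scaler0.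
Qed.

End Counit.

(** A coproduct has at most one counit: the two counit axioms evaluate
    (eps_s iota) ⊗ eps on the coproduct of [a] in two ways. *)
Lemma counit_incl (k : fieldType) (A X : lmodType k) (iota : A -> X)
    (Delta : A -> A ⊗ A) eps (Delta_s : X -> X ⊗ X) eps_s :
    is_coalgebra Delta eps -> is_coalgebra Delta_s eps_s ->
    linear iota -> injective iota ->
    (forall a, Delta_s (iota a) = tmap iota iota (Delta a)) ->
  forall a, eps_s (iota a) = eps a.
Proof.
move=> HA HX iL iI D a.
have eL : linear (eps : A -> k^o) := coalg_counit_linear HA.
have esL : linear (eps_s : X -> k^o) := coalg_counit_linear HX.
have B (V : lmodType k) (e : V -> k^o) : linear e ->
    bilinear_map (fun (x : V) (y : V) => (e x : k) *: y).
  move=> eL'; split=> [y c x x'|x c y y'] /=; first by rewrite eL' scalerDl scalerA.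
  by rewrite scalerDr !scalerA mulrC.
have E : tlift (fun x y => eps_s (iota x) *: y) (Delta a) = a.
  apply: iI; rewrite -[RHS](coalg_counitl HX) D tlift_tmap //; last exact: B.
  by rewrite (lin_tlift (h := iota)) //; apply: eq_tlift => x y; rewrite (linZ iL).
rewrite -[in RHS]E [RHS](lin_tlift (U' := k^o)) //.
rewrite -[in LHS](coalg_counitr HA a).
rewrite (lin_tlift (U' := k^o) (h := fun x => eps_s (iota x))).
  apply: (eq_tlift (U := k^o)) => x y; rewrite (linZ (V := k^o) eL).
  rewrite (linZ iL) (linZ (V := k^o) esL).
  exact: mulrC.
exact: (lin_comp (W := k^o) esL iL).
Qed.

(** * The tensor product of two exterior algebras *)

Section TensorExterior.
Variables (k : fieldType) (A B : algType k) (X Y : gradedAlgType k).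
Variables (iotaA : A -> X) (dX : X -> X) (iotaB : B -> Y) (dY : Y -> Y).
Hypotheses (HX : is_exterior_algebra iotaA dX) (HY : is_exterior_algebra iotaB dY).

Local Notation iotaAB := (tmap iotaA iotaB : A ⊗ B -> X ⊗s Y).

Lemma tens_incl_algmap : algmap iotaAB.
Proof.
have [aL [a1 aM]] := ext_incl_algmap HX; have [bL [b1 bM]] := ext_incl_algmap HY.
have tL : linear iotaAB := tmap_linear aL bL.
split=> //; split=> [|x y]; first by rewrite [LHS]tmapE // a1 b1.
move: x; apply: linear_tens_eq => [||a b].
- exact: (lin_comp tL (lin_mull (y : A ⊗ B))).
- exact: (lin_comp (lin_mull _) tL).
move: y; apply: linear_tens_eq => [||a' b'].
- exact: (lin_comp tL (lin_mulr (a ⊗t b : A ⊗ B))).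
- exact: (lin_comp (lin_mulr _) tL).
rewrite [X in tmap _ _ X](tens_mulE a b a' b') !tmapE // aM bM.
rewrite [RHS](stens_mulE _ _ (homog_incl HY b) (homog_incl HX a')).
by rewrite mul0n scale1r.
Qed.

(** In degree 1 the tensor product is A ⊗ (B dB) plus (A dA) ⊗ B, and
    a ⊗ (b db') = (a ⊗ b) d(1 ⊗ b'), (a da') ⊗ b = (a ⊗ b) d(a' ⊗ 1).  For
    generation, a subalgebra containing degrees 0 and 1 contains both factors,
    hence all products (x ⊗ 1)(1 ⊗ y). *)
Lemma tens_exterior : is_exterior_algebra iotaAB (stens_diff dX dY).
Proof.
have [tL tM] := tens_incl_algmap.
have aL := ext_incl_linear HX; have bL := ext_incl_linear HY.
have [a1 aM] := ext_incl_mul HX; have [b1 bM] := ext_incl_mul HY.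
have [r [[rL _] rE rK]] := ext_retraction HX.
have [s [[sL _] sE sK]] := ext_retraction HY.
have HXY := stens_dga (ext_dga HX) (ext_dga HY).
have dXL := ext_d_linear HX; have dYL := ext_d_linear HY.
have ih x : homog 0 (iotaAB x).
  elim/tens_ind: x => [|a b|x y Px Py].
  - by rewrite (lin0 tL); apply: homog0.
  - rewrite tmapE //.
    exact: homog_tens (homog_incl HX a) (homog_incl HY b).
  - by rewrite (linD tL); apply: homogD.
split=> //.
- move=> x y exy; have K : cancel iotaAB (tmap r s).
    move=> z; rewrite tmap_comp // (eq_tmap (f' := id) (g' := id) z rK sK).
    by rewrite [RHS]tens_sum.
  exact: (can_inj K).
- move=> x; split=> [<-|[z ->]]; last exact: ih.
  exists (tmap r s x); rewrite tmap_comp //.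
  rewrite [LHS]/gcomp /= /stens_comp big_ord1; apply: eq_tmap => u; first by rewrite rE.
  by rewrite sE.
- exact: dga_linear HXY.
- exact: dga_degree HXY.
- exact: dga_square HXY.
- exact: dga_leibniz HXY.
- move=> x; split=> [|[l ->]]; last first.
    apply: homog_sum => p; rewrite -[1%N]add0n; apply: homogM (ih _) _.
    exact: dga_degree HXY _ _ (ih _).
  move: x; apply: stens_homog_ind => [|x y [l1 ->] [l2 ->]|[|[|p]] q x y pq hx hy].
  + by exists [::]; rewrite big_nil.
  + by exists (l1 ++ l2); rewrite big_cat.
  + move: pq hy; rewrite add0n => -> /(ext_degree1 HY) [l ->].
    have [a ->] := (ext_degree0 HX _).1 hx.
    exists [seq (a ⊗t p.1, 1 ⊗t p.2) | p <- l]; rewrite big_map.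
    rewrite (lin_sum (h := tens _)); last exact: (tens_bilinear X Y).2.
    apply: eq_bigr => p _; rewrite !tmapE // a1.
    rewrite (stens_diffE _ dXL dYL (homog1 X)) (dga1 (ext_dga HX)) tens0l add0r scale1r.
    by rewrite [RHS](tens_sinr (iotaA a)).
  + move: pq hx hy; rewrite add1n => -[->] /(ext_degree1 HX) [l ->].
    move=> /(ext_degree0 HY) [b ->].
    exists [seq (p.1 ⊗t b, p.2 ⊗t 1) | p <- l]; rewrite big_map.
    rewrite (lin_sum (h := tens^~ _)); last exact: (tens_bilinear X Y).1.
    apply: eq_bigr => p _; rewrite !tmapE // b1.
    have h0 := homog_incl HX p.2.
    rewrite (stens_diffE _ dXL dYL h0) (dga1 (ext_dga HY)) tens0r scaler0 addr0.
    rewrite [RHS](stens_mulE _ _ (homog_incl HY b) (ext_d_degree HX h0)).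
    by rewrite mul0n scale1r mulr1.
  + by [].
- move=> S [S1 SL SM] Si Sh.
  have Sl x : sinl Y x \in S.
    move: x; have [lL [l1 lM]] := @sinl_algmap k X Y.
    apply: (ext_subalg_ind HX) => [|c x y hx hy|x y hx hy|a|x hx].
    + by rewrite l1.
    + by rewrite lL SL.
    + by rewrite lM SM.
    + by move: (Si (a ⊗t 1)); rewrite tmapE // b1.
    + exact/Sh/sinl_homog.
  have Sr y : sinr X y \in S.
    move: y; have [lL [l1 lM]] := @sinr_algmap k X Y.
    apply: (ext_subalg_ind HY) => [|c x y hx hy|x y hx hy|b|y hy].
    + by rewrite l1.
    + by rewrite lL SL.
    + by rewrite lM SM.
    + by move: (Si (1 ⊗t b)); rewrite tmapE // a1.
    + exact/Sh/sinr_homog.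
  apply: tens_ind => [|x y|x y Sx Sy].
  + by rewrite -(addNr (1 : X ⊗s Y)) -scaleN1r SL.
  + by rewrite -sinl_sinr SM.
  + by rewrite -[x]scale1r SL.
Qed.
End TensorExterior.

(** * Convolution and antipodes *)

Section Convolution.
Variables (k : fieldType) (C : lmodType k) (Delta : C -> C ⊗ C) (eps : C -> k).
Variable B : algType k.
Hypothesis HC : is_coalgebra Delta eps.
Implicit Types f g h : C -> B.

Definition conv f g : C -> B := fun c => tmul f g (Delta c).

Lemma conv_linear f g : linear f -> linear g -> linear (conv f g).
Proof. by move=> fL gL; apply: lin_comp (coalg_linear HC); apply: tmul_linear. Qed.

Lemma tmul_tassoc (U V W : lmodType k) (f : U -> B) (g : V -> B) (h : W -> B) x :
    linear f -> linear g -> linear h ->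
  tmul (tmul f g) h x = tmul f (tmul g h) (tassoc x).
Proof.
move=> fL gL hL; have fgL := tmul_linear fL gL; have ghL := tmul_linear gL hL.
have L1 := tmul_linear fgL hL; have L2 := tmul_linear fL ghL.
have aL := @tassoc_linear k U V W.
move: x; apply: (linear_tens_eq L1 (lin_comp L2 aL)) => x w; move: x.
have tL := (tens_bilinear (U ⊗ V) W).1 w.
apply: (linear_tens_eq (lin_comp L1 tL) (lin_comp L2 (lin_comp aL tL))) => u v.
by rewrite tassocE !tmulE // mulrA.
Qed.

Lemma convA f g h : linear f -> linear g -> linear h ->
  conv f (conv g h) = conv (conv f g) h.
Proof.
move=> fL gL hL; have DL := coalg_linear HC.
have fgL := tmul_linear fL gL; have ghL := tmul_linear gL hL.
apply/funext => c; rewrite /conv.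
have := tmul_tassoc (tmap Delta id (Delta c)) fL gL hL.
by rewrite (coalg_coassoc HC) !tmul_tmap.
Qed.

Lemma conv_unitl f : linear f -> conv (scalar_map B eps) f = f.
Proof.
move=> fL; apply/funext => c; rewrite -[in RHS](coalg_counitl HC c) lin_tlift //.
by apply: eq_tlift => x y; rewrite /scalar_map -scalerAl mul1r (linZ fL).
Qed.

Lemma conv_unitr f : linear f -> conv f (scalar_map B eps) = f.
Proof.
move=> fL; apply/funext => c; rewrite -[in RHS](coalg_counitr HC c) lin_tlift //.
by apply: eq_tlift => x y; rewrite /scalar_map -scalerAr mulr1 (linZ fL).
Qed.

(** An antipode is a convolution inverse of the identity; it stays an inverse after
    composition with a coalgebra map on the right and an algebra map on the left. *)
Lemma conv_antipode (H : algType k) (DeltaH : H -> H ⊗ H) epsH (S : H -> H)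
    (p : C -> H) (i : H -> B) :
    is_antipode DeltaH epsH S -> algmap i -> linear p ->
    (forall c, DeltaH (p c) = tmap p p (Delta c)) ->
    (forall c, epsH (p c) = eps c) ->
  conv (fun c => i (S (p c))) (fun c => i (p c)) = scalar_map B eps /\
  conv (fun c => i (p c)) (fun c => i (S (p c))) = scalar_map B eps.
Proof.
move=> [SL Sl Sr] ia pL pD pe; have [iL [i1 iM]] := ia; have idL := @lin_id k H.
split; apply/funext => c.
  rewrite /conv -(algmap_tmul (fun c => S (p c)) p _ ia).
  rewrite -(tmul_tmap (f := S) (g := id)) // -pD.
  by rewrite [tmul _ _ _]Sl (linZ iL) i1 pe.
rewrite /conv -(algmap_tmul p (fun c => S (p c)) _ ia).
rewrite -(tmul_tmap (f := id) (g := S)) // -pD.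
by rewrite [tmul _ _ _]Sr (linZ iL) i1 pe.
Qed.

End Convolution.

Section FactorAntipode.
Variables (k : fieldType) (B H A : algType k).
Variables (Delta : B -> B ⊗ B) (eps : B -> k).
Variables (DeltaH : H -> H ⊗ H) (epsH : H -> k) (SH : H -> H).
Variables (DeltaA : A -> A ⊗ A) (epsA : A -> k) (SA : A -> A).
Variables (pH : B -> H) (iH : H -> B) (pA : B -> A) (iA : A -> B).

Definition factor_antipode : B -> B :=
  conv Delta (fun b => iA (SA (pA b))) (fun b => iH (SH (pH b))).

(** The product of two invertible elements is invertible, with the inverses
    multiplied in reverse order; here the product is the identity map. *)
Lemma factor_antipodeP :
    is_coalgebra Delta eps -> is_antipode DeltaH epsH SH -> is_antipode DeltaA epsA SA ->
    algmap iH -> algmap iA -> linear pH -> linear pA ->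
    (forall b, DeltaH (pH b) = tmap pH pH (Delta b)) ->
    (forall b, DeltaA (pA b) = tmap pA pA (Delta b)) ->
    (forall b, epsH (pH b) = eps b) -> (forall b, epsA (pA b) = eps b) ->
    (forall b, conv Delta (fun b => iH (pH b)) (fun b => iA (pA b)) b = b) ->
  is_antipode Delta eps factor_antipode.
Proof.
move=> HB aH aA iHa iAa pHL pAL pHD pAD pHe pAe fact.
have [hl hr] := conv_antipode (Delta := Delta) (eps := eps) aH iHa pHL pHD pHe.
have [al ar] := conv_antipode (Delta := Delta) (eps := eps) aA iAa pAL pAD pAe.
have [SHL _ _] := aH; have [SAL _ _] := aA.
have [iHL _] := iHa; have [iAL _] := iAa.
have L1 := lin_comp iHL pHL; have L2 := lin_comp iAL pAL.
have L3 := lin_comp iHL (lin_comp SHL pHL); have L4 := lin_comp iAL (lin_comp SAL pAL).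
have fid : id = conv Delta (fun b => iH (pH b)) (fun b => iA (pA b)).
  by apply/funext => b; rewrite fact.
have cL := conv_linear HB; have cA := convA HB.
(* Associate so that the factors at the junction cancel first. *)
have idE b : conv Delta factor_antipode id b = scalar_map B eps b.
  rewrite fid /factor_antipode -cA ?(cA _ (fun b => iH (SH (pH b)))) //; last exact: cL.
  by rewrite hl (conv_unitl HB) // al.
have idE' b : conv Delta id factor_antipode b = scalar_map B eps b.
  rewrite fid /factor_antipode -cA ?(cA _ (fun b => iA (pA b))) //; last exact: cL.
  by rewrite ar (conv_unitl HB) // hr.
by split; [exact: cL|exact: idE|exact: idE'].
Qed.
End FactorAntipode.

(** Applying the algebra map [rho] to the antipode axioms at [iota a] gives those of
    [Delta], because [rho] undoes [iota] on the factor on which the antipode does not act. *)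
Lemma restrict_antipode (k : fieldType) (A X : algType k) (iota : A -> X) (rho : X -> A)
    (Delta : A -> A ⊗ A) eps (Delta_s : X -> X ⊗ X) eps_s S :
    linear iota -> algmap rho -> cancel iota rho ->
    (forall a, Delta_s (iota a) = tmap iota iota (Delta a)) ->
    (forall a, eps_s (iota a) = eps a) ->
    is_antipode Delta_s eps_s S ->
  is_antipode Delta eps (fun a => rho (S (iota a))).
Proof.
move=> iL ra rK Di ei [SL Sl Sr]; have [rL [r1 rM]] := ra; have idL := @lin_id k X.
split=> [|a|a]; first exact: (lin_comp rL (lin_comp SL iL)).
  have := congr1 rho (Sl (iota a)); rewrite -[tlift _ _]/(tmul S id _).
  rewrite Di tmul_tmap // (algmap_tmul _ _ _ ra) (linZ rL) r1 ei => <-.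
  by apply: eq_tlift => x y; rewrite rK.
have := congr1 rho (Sr (iota a)); rewrite -[tlift _ _]/(tmul id S _).
rewrite Di tmul_tmap // (algmap_tmul _ _ _ ra) (linZ rL) r1 ei => <-.
by apply: eq_tlift => x y; rewrite rK.
Qed.

(** * Coalgebra axioms propagate from degree 0 *)

Section CoalgebraPropagation.
Variables (k : fieldType) (A : algType k) (X : gradedAlgType k).
Variables (iota : A -> X) (d : X -> X).
Variables (Delta : A -> A ⊗ A) (eps : A -> k).
Variables (Delta_s : X -> X ⊗s X) (eps_s : X -> k).

Lemma ext_coalgebra :
    is_exterior_algebra iota d -> is_coalgebra Delta eps ->
    dgmap d (stens_diff d d) Delta_s ->
    scalar eps_s -> monoid_morphism eps_s ->
    (forall x, has_parity true x -> eps_s x = 0) ->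
    (forall a, Delta_s (iota a) = tmap iota iota (Delta a)) ->
    (forall a, eps_s (iota a) = eps a) ->
  is_coalgebra Delta_s eps_s.
Proof.
move=> HX HA DD eL eM eodd Di ei.
have dX := ext_dga HX; have dXX := stens_dga dX dX.
have iL := ext_incl_linear HX; have DL := algmapL (dgmap_alg DD).
have D0L := coalg_linear HA; have idL (V : lmodType k) := @lin_id k V.
have ed := counit_dgmap HX eL eM eodd dX.
have eL' := algmapL (dgmap_alg ed).
have sc := counit_scommute HX eL eM eodd.
split=> // [|c|c].
- apply: (ext_dgmap_eq HX (dZ := stens_diff d (stens_diff d d))) => [||a].
  + apply: (dgmap_comp (tassoc_dgmap dX dX dX)); apply: (dgmap_comp _ DD).
    exact: (tmap_dgmap dX dX dXX dX DD (dgmap_id d)).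
  + apply: (dgmap_comp _ DD).
    exact: (tmap_dgmap dX dX dX dXX (dgmap_id d) DD).
  rewrite Di !tmap_comp //.
  rewrite (eq_tmap (f' := fun a => tmap iota iota (Delta a))
    (g' := fun a => iota (id a)) _ Di) //.
  rewrite (eq_tmap (f := fun v => id (iota v)) (f' := fun a => iota (id a))
    (g' := fun a => tmap iota iota (Delta a)) _ _ Di) //.
  rewrite -(tmap_comp (f := tmap iota iota) (g := iota)) //; last exact: tmap_linear.
  rewrite -(tmap_comp (f := iota) (g := tmap iota iota)) //; last exact: tmap_linear.
  by rewrite tassoc_tmap // (coalg_coassoc HA).
- suff: tmul (scalar_map X eps_s) id (Delta_s c) = c.
    by move=> {2}<-; apply: eq_tlift => x y; rewrite -scalerAl mul1r.
  move: c; apply: (ext_dgmap_eq HX (dZ := d)) => [||a].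
  + apply: (dgmap_comp _ DD); exact: (tmul_dgmap _ _ _ ed (dgmap_id d) (sc _ _ _)).
  + exact: dgmap_id.
  rewrite Di tmul_tmap //.
  rewrite -[in RHS](coalg_counitl HA a) (lin_tlift _ _ iL).
  by apply: eq_tlift => x y; rewrite /scalar_map ei -scalerAl mul1r (linZ iL).
- suff: tmul id (scalar_map X eps_s) (Delta_s c) = c.
    by move=> {2}<-; apply: eq_tlift => x y; rewrite -scalerAr mulr1.
  move: c; apply: (ext_dgmap_eq HX (dZ := d)) => [||a].
  + apply: (dgmap_comp _ DD).
    exact: (tmul_dgmap _ _ _ (dgmap_id d) ed (scommute_sym (sc _ _ _))).
  + exact: dgmap_id.
  rewrite Di tmul_tmap //.
  rewrite -[in RHS](coalg_counitr HA a) (lin_tlift _ _ iL).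
  by apply: eq_tlift => x y; rewrite /scalar_map ei -scalerAr mulr1 (linZ iL).
Qed.
End CoalgebraPropagation.

(** * The super double cross coproduct as an induced map *)

(** The Koszul sign is undone by the one coming from super-commutation. *)
Lemma koszul_scommute (k : fieldType) (X Y : gradedAlgType k) (Z : algType k)
    (f : X -> Z) (g : Y -> Z) x y :
  linear f -> linear g -> scommute f g -> koszul (fun x y => f x * g y) x y = g y * f x.
Proof.
move=> fL gL fg; have B := mul_bilinear fL gL; have [Kl Kr] := koszul_bilinear B.
move: x; apply: linear_homog_eq => [||m x hx].
- exact: Kl.
- exact: (lin_comp (lin_mulr _) fL).
move: y; apply: linear_homog_eq => [||n y hy].
- exact: Kr.
- exact: (lin_comp (lin_mull _) gL).
by rewrite (koszul_homog B hx hy) (fg _ _ _ _ hx hy) signZK.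
Qed.

Lemma lin_koszul (k : fieldType) (X Y : gradedAlgType k) (U V : lmodType k)
    (h : U -> V) (f : X -> Y -> U) x y :
  linear h -> h (koszul f x y) = koszul (fun x y => h (f x y)) x y.
Proof.
move=> hL; rewrite /koszul (lin_sum _ _ _ hL); apply: eq_bigr => i _.
by rewrite (lin_sum _ _ _ hL); apply: eq_bigr => j _; rewrite (linZ hL).
Qed.

Lemma tlift2_mul (k : fieldType) (V W V' W' : lmodType k) (Z : algType k)
    (f : V -> W -> Z) (g : V' -> W' -> Z) x y :
  tlift2 (fun v w v' w' => f v w * g v' w') x y = tlift f x * tlift g y.
Proof.
rewrite /tlift2 -[RHS]/((fun z => z * tlift g y) (tlift f x)).
rewrite lin_tlift; last exact: lin_mull.
apply: eq_tlift => v w; rewrite -[RHS]/((fun z => f v w * z) (tlift g y)).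
by rewrite lin_tlift //; apply: lin_mulr.
Qed.

Section DoubleCross.
Variables (k : fieldType) (X Y : gradedAlgType k) (dX : X -> X) (dY : Y -> Y).
Variables (DX : X -> X ⊗s X) (DY : Y -> Y ⊗s Y).
Variables (alpha : X -> X ⊗s Y) (beta : Y -> X ⊗s Y).
Hypotheses (HX : is_dga dX) (HY : is_dga dY).
Hypothesis (HDX : dgmap dX (stens_diff dX dX) DX).
Hypothesis (HDY : dgmap dY (stens_diff dY dY) DY).
Hypothesis (Ha : dgmap dX (stens_diff dX dY) alpha).
Hypothesis (Hb : dgmap dY (stens_diff dX dY) beta).
Hypothesis (Hab : scommute alpha beta).

Local Notation B := (Y ⊗s X).
Local Notation dB := (stens_diff dY dX).
Local Notation dT := (stens_diff dB dB).

Definition leg1 (y : Y) : B ⊗s B := sinl B (sinl X y).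
Definition leg2 (x : X) : B ⊗s B := sinl B (sinr Y x).
Definition leg3 (y : Y) : B ⊗s B := sinr B (sinl X y).
Definition leg4 (x : X) : B ⊗s B := sinr B (sinr Y x).
Definition leg23 : X ⊗s Y -> B ⊗s B := tmul leg2 leg3.

(** The restrictions of the coproduct to the factors Y and X: they send y to
    y1 ⊗ beta(y2) ⊗ 1 and x to 1 ⊗ alpha(x1) ⊗ x2. *)
Definition comulY (y : Y) : B ⊗s B := tmul leg1 (fun y => leg23 (beta y)) (DY y).
Definition comulX (x : X) : B ⊗s B := tmul (fun x => leg23 (alpha x)) leg4 (DX x).
Definition comulYX : B -> B ⊗s B := tmul comulY comulX.

Let HB := stens_dga HY HX.
Let HT := stens_dga HB HB.

Lemma leg1_dgmap : dgmap dY dT leg1.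
Proof. exact: (dgmap_comp (sinl_dgmap HB HB) (sinl_dgmap HY HX)). Qed.
Lemma leg2_dgmap : dgmap dX dT leg2.
Proof. exact: (dgmap_comp (sinl_dgmap HB HB) (sinr_dgmap HY HX)). Qed.
Lemma leg3_dgmap : dgmap dY dT leg3.
Proof. exact: (dgmap_comp (sinr_dgmap HB HB) (sinl_dgmap HY HX)). Qed.
Lemma leg4_dgmap : dgmap dX dT leg4.
Proof. exact: (dgmap_comp (sinr_dgmap HB HB) (sinr_dgmap HY HX)). Qed.

Lemma scommute_legs_lr (X1 X2 : gradedAlgType k) (f : X1 -> B) (g : X2 -> B) :
    (forall n x, homog n x -> homog n (f x)) ->
    (forall n x, homog n x -> homog n (g x)) ->
  scommute (fun x => sinl B (f x)) (fun x => sinr B (g x)).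
Proof.
move=> fh gh; apply: (scommute_comp fh).
apply/scommute_sym/(scommute_comp gh)/scommute_sym; exact: scommute_sinl_sinr.
Qed.

Lemma leg1_leg2 : scommute leg1 leg2.
Proof. exact: (scommute_post (sinl_algmap _ _) (@scommute_sinl_sinr k Y X)). Qed.
Lemma leg1_leg3 : scommute leg1 leg3.
Proof. by apply: scommute_legs_lr; apply: sinl_homog. Qed.
Lemma leg1_leg4 : scommute leg1 leg4.
Proof. by apply: scommute_legs_lr; [apply: sinl_homog|apply: sinr_homog]. Qed.
Lemma leg2_leg3 : scommute leg2 leg3.
Proof. by apply: scommute_legs_lr; [apply: sinr_homog|apply: sinl_homog]. Qed.
Lemma leg2_leg4 : scommute leg2 leg4.
Proof. by apply: scommute_legs_lr; apply: sinr_homog. Qed.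
Lemma leg3_leg4 : scommute leg3 leg4.
Proof. exact: (scommute_post (sinr_algmap _ _) (@scommute_sinl_sinr k Y X)). Qed.

Let leg1L := algmapL (dgmap_alg leg1_dgmap).
Let leg2L := algmapL (dgmap_alg leg2_dgmap).
Let leg3L := algmapL (dgmap_alg leg3_dgmap).
Let leg4L := algmapL (dgmap_alg leg4_dgmap).

Lemma leg23_dgmap : dgmap (stens_diff dX dY) dT leg23.
Proof. exact: (tmul_dgmap HX HY HT leg2_dgmap leg3_dgmap leg2_leg3). Qed.

Let leg23b := dgmap_comp leg23_dgmap Hb.
Let leg23a := dgmap_comp leg23_dgmap Ha.

Lemma leg1_leg23 : scommute leg1 leg23.
Proof.
by apply: scommute_sym; apply: scommute_tmul => //; apply: scommute_sym;
  [exact: leg1_leg2|exact: leg1_leg3].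
Qed.

Lemma leg23_leg4 : scommute leg23 leg4.
Proof. by apply: scommute_tmul => //; [exact: leg2_leg4|exact: leg3_leg4]. Qed.

Lemma leg1_leg23_beta : scommute leg1 (fun y => leg23 (beta y)).
Proof.
exact/scommute_sym/(scommute_comp (dgmap_homog Hb))/scommute_sym/leg1_leg23.
Qed.

Lemma leg1_leg23_alpha : scommute leg1 (fun x => leg23 (alpha x)).
Proof.
exact/scommute_sym/(scommute_comp (dgmap_homog Ha))/scommute_sym/leg1_leg23.
Qed.

Lemma leg23_alpha_leg4 : scommute (fun x => leg23 (alpha x)) leg4.
Proof. exact: (scommute_comp (dgmap_homog Ha) leg23_leg4). Qed.

Lemma leg23_beta_leg4 : scommute (fun y => leg23 (beta y)) leg4.
Proof. exact: (scommute_comp (dgmap_homog Hb) leg23_leg4). Qed.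

Lemma comulY_dgmap : dgmap dY dT comulY.
Proof.
exact: (dgmap_comp (tmul_dgmap HY HY HT leg1_dgmap leg23b leg1_leg23_beta) HDY).
Qed.

Lemma comulX_dgmap : dgmap dX dT comulX.
Proof.
exact: (dgmap_comp (tmul_dgmap HX HX HT leg23a leg4_dgmap leg23_alpha_leg4) HDX).
Qed.

(** Among the four pairs of factors only beta(y2) and alpha(x1) share legs, and
    these super-commute by hypothesis. *)
Lemma comulY_comulX : scommute comulY comulX.
Proof.
have bL := algmapL (dgmap_alg leg23b); have aL := algmapL (dgmap_alg leg23a).
apply: (scommute_comp (dgmap_homog HDY)).
apply/scommute_sym/(scommute_comp (dgmap_homog HDX))/scommute_sym.
apply: scommute_tmul => //; apply: scommute_sym; apply: scommute_tmul => //.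
- exact: (scommute_sym leg1_leg23_alpha).
- exact: (scommute_sym leg1_leg4).
- exact: (scommute_post (dgmap_alg leg23_dgmap) Hab).
- exact: (scommute_sym leg23_beta_leg4).
Qed.

Lemma comulYX_dgmap : dgmap dB dT comulYX.
Proof. exact: (tmul_dgmap HY HX HT comulY_dgmap comulX_dgmap comulY_comulX). Qed.

Lemma comulYX_sinl y : comulYX (sinl X y) = comulY y.
Proof.
have YL := algmapL (dgmap_alg comulY_dgmap).
have [XL [X1 _]] := dgmap_alg comulX_dgmap.
by rewrite /comulYX /sinl tmulE // X1 mulr1.
Qed.

Lemma comulYX_sinr x : comulYX (sinr Y x) = comulX x.
Proof.
have [YL [Y1 _]] := dgmap_alg comulY_dgmap.
have XL := algmapL (dgmap_alg comulX_dgmap).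
by rewrite /comulYX /sinr tmulE // Y1 mul1r.
Qed.

Lemma leg23_insert (y : Y) (x : X) z :
  leg1 y * leg23 z * leg4 x = tlift (fun u v => (y ⊗t u) ⊗t (v ⊗t x)) z.
Proof.
rewrite -[LHS]/((fun t => leg1 y * t * leg4 x) (leg23 z)).
rewrite lin_tlift; last exact: (lin_comp (lin_mull (leg4 x)) (lin_mulr (leg1 y))).
apply: eq_tlift => u v; rewrite mulrA.
have [_ [_ lM]] := @sinl_algmap k B B; have [_ [_ rM]] := @sinr_algmap k B B.
by rewrite -lM -[LHS]mulrA -rM !sinl_sinr.
Qed.

(** Once the middle factor is written as a product inside [leg23], the signed
    product alpha(x1) beta(y2) is beta(y2) alpha(x1), which splits the formula into
    a part depending on y and a part depending on x. *)
Lemma sdcc_comulE z : sdcc_comul DX DY alpha beta z = comulYX z.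
Proof.
have aL := algmapL (dgmap_alg Ha); have bL := algmapL (dgmap_alg Hb).
apply: eq_tlift => y x; rewrite -tlift2_mul.
apply: eq_tlift => y1 y2; apply: eq_tlift => x1 x2.
have hL : linear (fun z => leg1 y1 * leg23 z * leg4 x2).
  apply: (lin_comp (lin_mull (leg4 x2))); apply: (lin_comp (lin_mulr (leg1 y1))).
  exact: algmapL (dgmap_alg leg23_dgmap).
under eq_koszul => u v do rewrite -leg23_insert.
rewrite -(lin_koszul _ _ _ hL) (koszul_scommute _ _ aL bL Hab).
have [_ [_ ->]] := dgmap_alg leg23_dgmap.
by rewrite !mulrA.
Qed.

End DoubleCross.

Section Degree0.
Variables (k : fieldType) (A H : algType k).
Variables (DeltaA : A -> A ⊗ A) (DeltaH : H -> H ⊗ H).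
Variables (alpha0 : A -> A ⊗ H) (beta0 : H -> A ⊗ H).
Variables (X Y : gradedAlgType k) (iotaA : A -> X) (dX : X -> X).
Variables (iotaH : H -> Y) (dY : Y -> Y).
Variables (DX : X -> X ⊗s X) (DY : Y -> Y ⊗s Y).
Variables (alpha : X -> X ⊗s Y) (beta : Y -> X ⊗s Y).
Hypotheses (HX : is_exterior_algebra iotaA dX) (HY : is_exterior_algebra iotaH dY).
Hypothesis (HDX : dgmap dX (stens_diff dX dX) DX).
Hypothesis (HDY : dgmap dY (stens_diff dY dY) DY).
Hypothesis (Ha : dgmap dX (stens_diff dX dY) alpha).
Hypothesis (Hb : dgmap dY (stens_diff dX dY) beta).
Hypothesis (Hab : scommute alpha beta).
Hypothesis (DXi : forall a, DX (iotaA a) = tmap iotaA iotaA (DeltaA a)).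
Hypothesis (DYi : forall h, DY (iotaH h) = tmap iotaH iotaH (DeltaH h)).
Hypothesis (alphai : forall a, alpha (iotaA a) = tmap iotaA iotaH (alpha0 a)).
Hypothesis (betai : forall h, beta (iotaH h) = tmap iotaA iotaH (beta0 h)).

(** In degree 0 no sign occurs and the formula for the ungraded coproduct is
    recovered. *)
Lemma comulYX_incl z : comulYX DX DY alpha beta (tmap iotaH iotaA z) =
  tmap (tmap iotaH iotaA) (tmap iotaH iotaA) (dcc_comul DeltaA DeltaH alpha0 beta0 z).
Proof.
have dgX := ext_dga HX; have dgY := ext_dga HY.
have iAL := ext_incl_linear HX; have iHL := ext_incl_linear HY.
have iHAL : linear (tmap iotaH iotaA) := tmap_linear iHL iAL.
have iL := tmap_linear iHAL iHAL.
have l1 := algmapL (dgmap_alg (leg1_dgmap dgX dgY)).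
have l4 := algmapL (dgmap_alg (leg4_dgmap dgX dgY)).
have l23 := algmapL (dgmap_alg (leg23_dgmap dgX dgY)).
have aL := algmapL (dgmap_alg Ha); have bL := algmapL (dgmap_alg Hb).
have l23a := lin_comp l23 aL; have l23b := lin_comp l23 bL.
rewrite /dcc_comul (lin_tlift _ _ iL) /comulYX tmul_tmap //; last first.
- exact: algmapL (dgmap_alg (comulX_dgmap dgX dgY HDX Ha)).
- exact: algmapL (dgmap_alg (comulY_dgmap dgX dgY HDY Hb)).
apply: eq_tlift => h a.
rewrite /comulY /comulX DXi DYi !tmul_tmap //.
rewrite -tlift2_mul /tlift2 (lin_tlift _ _ iL); apply: eq_tlift => h1 h2.
rewrite (lin_tlift _ _ iL); apply: eq_tlift => a1 a2.
rewrite (lin_tlift _ _ iL) alphai betai.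
have [_ [_ l23M]] := dgmap_alg (leg23_dgmap dgX dgY).
rewrite mulrA -[_ * leg23 _ * leg23 _]mulrA -l23M.
have := Hab (homog_incl HX a1) (homog_incl HY h2).
rewrite mul0n scale1r alphai betai => <-.
have [_ [_ <-]] := tens_incl_algmap HX HY.
rewrite [LHS]leg23_insert.
set F := (F in tlift F _ = _).
have FB : bilinear_map F.
  split=> [v c u u'|u c v v']; rewrite /F; first by rewrite tensPr tensPl.
  by rewrite tensPl tensPr.
rewrite (tlift_tmap _ FB iAL iHL).
apply: eq_tlift => u v.
by rewrite /F tmapE // tmapE // tmapE.
Qed.

End Degree0.

(** * Counit and antipode of the super double cross coproduct *)

Section SuperAntipode.
Variables (k : fieldType) (A H : algType k).
Variables (X Y : gradedAlgType k) (iotaA : A -> X) (dX : X -> X).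
Variables (iotaH : H -> Y) (dY : Y -> Y).
Variables (DX : X -> X ⊗s X) (DY : Y -> Y ⊗s Y) (eX : X -> k) (eY : Y -> k).
Variables (alpha : X -> X ⊗s Y) (beta : Y -> X ⊗s Y).
Hypotheses (HX : is_exterior_algebra iotaA dX) (HY : is_exterior_algebra iotaH dY).
Hypotheses (SX : is_super_bialgebra DX eX) (SY : is_super_bialgebra DY eY).

Local Notation B := (Y ⊗s X).
Local Notation dB := (stens_diff dY dX).
Local Notation eB := (sdcc_counit eX eY : B -> k).

Let dgX := ext_dga HX.
Let dgY := ext_dga HY.
Let CX := sbialg_coalgebra SX.
Let CY := sbialg_coalgebra SY.
Let eXL := coalg_counit_linear CX.
Let eYL := coalg_counit_linear CY.
Let eXM := sbialg_counit SX.
Let eYM := sbialg_counit SY.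
Let eXo := sbialg_counit_even SX.
Let eYo := sbialg_counit_even SY.
Let eXp n x := @counit_pos _ _ _ _ _ _ HX eXL eXM eXo n x.
Let eYp n x := @counit_pos _ _ _ _ _ _ HY eYL eYM eYo n x.

Lemma sdcc_counit_algmap : algmap (eB : B -> k^o).
Proof.
apply: (tmul_algmap (Z := k^o) (f := eY : Y -> k^o) (g := eX : X -> k^o)) => //.
move=> m n y x hy hx; have [m0|m0] := posnP m.
  by rewrite m0 mul0n scale1r mulrC.
have [n0|n0] := posnP n; first by rewrite n0 muln0 scale1r mulrC.
by rewrite (eXp n0 hx) mulr0 mul0r scaler0.
Qed.

Lemma sdcc_counit_tens y x : eB (y ⊗t x) = eY y * eX x.
Proof. exact: (tmulE (Z := k^o) (f := eY) (g := eX)). Qed.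

Lemma sdcc_counit_odd x : has_parity true x -> eB x = 0.
Proof.
have [eBL _] := sdcc_counit_algmap.
move: x; apply: parity_ind => [|x y Px Py|n z no].
- exact: lin0 eBL.
- by rewrite (linD eBL) Px Py addr0.
move: z; apply: stens_homog_ind => [|x y Px Py|p q x y pq hx hy].
- exact: lin0 eBL.
- by rewrite (linD eBL) Px Py addr0.
rewrite sdcc_counit_tens; have [p0|p0] := posnP p; last by rewrite (eYp p0 hx) mul0r.
have [q0|q0] := posnP q; last by rewrite (eXp q0 hy) mulr0.
by move: no; rewrite -pq p0 q0.
Qed.

Hypothesis (HDX : dgmap dX (stens_diff dX dX) DX).
Hypothesis (HDY : dgmap dY (stens_diff dY dY) DY).
Hypothesis (Ha : dgmap dX (stens_diff dX dY) alpha).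
Hypothesis (Hb : dgmap dY (stens_diff dX dY) beta).
Hypothesis (Hab : scommute alpha beta).
Hypothesis (Hac : forall x, tlift (fun x y => eY y *: x) (alpha x) = x).
Hypothesis (Hbc : forall y, tlift (fun x y => eX x *: y) (beta y) = y).
Hypothesis (CB : is_coalgebra (comulYX DX DY alpha beta) eB).

Let eBa := sdcc_counit_algmap.
Let eBL := algmapL eBa.
Let HB := stens_dga dgY dgX.
Let sXc (Z : gradedAlgType k) (U : gradedAlgType k) (g : U -> Z) :=
  counit_scommute HX eXL eXM eXo g.
Let sYc (Z : gradedAlgType k) (U : gradedAlgType k) (g : U -> Z) :=
  counit_scommute HY eYL eYM eYo g.
Let sXd (Z : gradedAlgType k) (dZ : Z -> Z) (HZ : is_dga dZ) :=
  counit_dgmap HX eXL eXM eXo HZ.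
Let sYd (Z : gradedAlgType k) (dZ : Z -> Z) (HZ : is_dga dZ) :=
  counit_dgmap HY eYL eYM eYo HZ.

(** The projections id ⊗ eps and eps ⊗ id of Y ⊗ X onto its factors, and the same
    maps on X ⊗ Y, where the coactions take their values. *)
Definition projY : B -> Y := tmul id (scalar_map Y eX).
Definition projX : B -> X := tmul (scalar_map X eY) id.
Definition counitX_id : X ⊗s Y -> Y := tmul (scalar_map Y eX) id.
Definition id_counitY : X ⊗s Y -> X := tmul id (scalar_map X eY).

Lemma projY_dgmap : dgmap dB dY projY.
Proof.
exact: (tmul_dgmap dgY dgX dgY (dgmap_id dY) (sXd dgY) (scommute_sym (sXc _))).
Qed.
Lemma projX_dgmap : dgmap dB dX projX.
Proof. exact: (tmul_dgmap dgY dgX dgX (sYd dgX) (dgmap_id dX) (sYc _)). Qed.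
Lemma counitX_id_dgmap : dgmap (stens_diff dX dY) dY counitX_id.
Proof. exact: (tmul_dgmap dgX dgY dgY (sXd dgY) (dgmap_id dY) (sXc _)). Qed.
Lemma id_counitY_dgmap : dgmap (stens_diff dX dY) dX id_counitY.
Proof.
exact: (tmul_dgmap dgX dgY dgX (dgmap_id dX) (sYd dgX) (scommute_sym (sYc _))).
Qed.

Let sXa (Z : gradedAlgType k) : algmap (scalar_map Z eX) := scalar_map_algmap Z eXL eXM.
Let sYa (Z : gradedAlgType k) : algmap (scalar_map Z eY) := scalar_map_algmap Z eYL eYM.
Let sBa (Z : gradedAlgType k) : algmap (scalar_map Z eB) :=
  scalar_map_algmap Z eBL (algmapM eBa).

Lemma projY_sinl y : projY (sinl X y) = y.
Proof. by rewrite [LHS]tmul_sinl //; apply: algmap_id. Qed.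
Lemma projY_sinr x : projY (sinr Y x) = scalar_map Y eX x.
Proof. by rewrite [LHS]tmul_sinr //; apply: algmap_id. Qed.
Lemma projX_sinl y : projX (sinl X y) = scalar_map X eY y.
Proof. by rewrite [LHS]tmul_sinl //; apply: algmap_id. Qed.
Lemma projX_sinr x : projX (sinr Y x) = x.
Proof. by rewrite [LHS]tmul_sinr //; apply: algmap_id. Qed.
Lemma counitX_id_sinl x : counitX_id (sinl Y x) = scalar_map Y eX x.
Proof. by rewrite [LHS]tmul_sinl //; apply: algmap_id. Qed.
Lemma counitX_id_sinr y : counitX_id (sinr X y) = y.
Proof. by rewrite [LHS]tmul_sinr //; apply: algmap_id. Qed.
Lemma id_counitY_sinl x : id_counitY (sinl Y x) = x.
Proof. by rewrite [LHS]tmul_sinl //; apply: algmap_id. Qed.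
Lemma id_counitY_sinr y : id_counitY (sinr X y) = scalar_map X eY y.
Proof. by rewrite [LHS]tmul_sinr //; apply: algmap_id. Qed.

Lemma scalar_map_counit_sinl (Z : algType k) y :
  scalar_map Z (eB : B -> k) (sinl X y) = scalar_map Z eY y.
Proof. by rewrite /scalar_map sdcc_counit_tens (eXM.1) mulr1. Qed.
Lemma scalar_map_counit_sinr (Z : algType k) x :
  scalar_map Z (eB : B -> k) (sinr Y x) = scalar_map Z eX x.
Proof. by rewrite /scalar_map sdcc_counit_tens (eYM.1) mul1r. Qed.

Lemma counitX_id_beta y : counitX_id (beta y) = y.
Proof. by rewrite -[RHS]Hbc; apply: eq_tlift => x z; rewrite -scalerAl mul1r. Qed.
Lemma id_counitY_alpha x : id_counitY (alpha x) = x.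
Proof. by rewrite -[RHS]Hac; apply: eq_tlift => z y; rewrite -scalerAr mulr1. Qed.

Lemma leg23_sinl (x : X) : leg23 (sinl Y x) = leg2 Y x.
Proof.
by rewrite [LHS]tmul_sinl //; [exact: dgmap_alg (leg2_dgmap dgX dgY)
  |exact: dgmap_alg (leg3_dgmap dgX dgY)].
Qed.
Lemma leg23_sinr (y : Y) : leg23 (sinr X y) = leg3 X y.
Proof.
by rewrite [LHS]tmul_sinr //; [exact: dgmap_alg (leg2_dgmap dgX dgY)
  |exact: dgmap_alg (leg3_dgmap dgX dgY)].
Qed.

(** Algebra maps on X ⊗ Y are compared on the two factors; this computes how maps
    out of (Y ⊗ X) ⊗ (Y ⊗ X) act on the middle legs without expanding the values of
    the coactions. *)
Lemma leg23_eq (Z : algType k) (f : B ⊗s B -> Z) (g : X ⊗s Y -> Z) :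
    algmap f -> algmap g ->
    (forall x : X, f (leg2 Y x) = g (sinl Y x)) ->
    (forall y : Y, f (leg3 X y) = g (sinr X y)) ->
  forall z, f (leg23 z) = g z.
Proof.
move=> fa ga f2 f3; apply: algmap_stens_eq => // [|x|y].
- exact: (algmap_comp fa (dgmap_alg (leg23_dgmap dgX dgY))).
- by rewrite leg23_sinl.
- by rewrite leg23_sinr.
Qed.

Lemma algmap_comulY (Z : algType k) (f : B ⊗s B -> Z) y : algmap f ->
  f (comulY DY beta y) =
  tmul (fun y => f (leg1 X y)) (fun y => f (leg23 (beta y))) (DY y).
Proof. by move=> fa; rewrite /comulY (algmap_tmul _ _ _ fa). Qed.

Lemma algmap_comulX (Z : algType k) (f : B ⊗s B -> Z) x : algmap f ->
  f (comulX DX alpha x) =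
  tmul (fun x => f (leg23 (alpha x))) (fun x => f (leg4 Y x)) (DX x).
Proof. by move=> fa; rewrite /comulX (algmap_tmul _ _ _ fa). Qed.

Lemma comulYX_sinlE y : comulYX DX DY alpha beta (sinl X y) = comulY DY beta y.
Proof. exact: (comulYX_sinl dgX dgY HDX HDY Ha Hb). Qed.
Lemma comulYX_sinrE x : comulYX DX DY alpha beta (sinr Y x) = comulX DX alpha x.
Proof. exact: (comulYX_sinr dgX dgY HDX HDY Ha Hb). Qed.

Let pYa := dgmap_alg projY_dgmap.
Let pXa := dgmap_alg projX_dgmap.
Let eLa := dgmap_alg counitX_id_dgmap.
Let eRa := dgmap_alg id_counitY_dgmap.
Let sBc (Z : gradedAlgType k) (U : gradedAlgType k) (g : U -> Z) :=
  counit_scommute (tens_exterior HY HX) eBL (algmapM eBa) sdcc_counit_odd g.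

(** This comes from the left counit axiom of the coproduct on Y ⊗ X, which at 1 ⊗ x
    reads (eps ⊗ id) alpha(x1) ⊗ x2 = 1 ⊗ x, by applying id ⊗ eps. *)
Lemma counitX_id_alpha x : counitX_id (alpha x) = scalar_map Y eX x.
Proof.
pose f : B ⊗s B -> Y := tmul (scalar_map Y eB) projY.
have fa : algmap f by apply: tmul_algmap => //; apply: sBc.
have fE b : f (comulYX DX DY alpha beta b) = projY b.
  exact: (congr1 (fun h => h b) (conv_unitl CB (algmapL pYa))).
have fl b : f (sinl B b) = scalar_map Y eB b by exact: tmul_sinl.
have fr b : f (sinr B b) = projY b by exact: tmul_sinr.
have f23 z : f (leg23 z) = counitX_id z.
  apply: (leg23_eq (g := fun z => counitX_id z)) => // [u|v];
    first by rewrite fl scalar_map_counit_sinr counitX_id_sinl.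
  by rewrite fr projY_sinl counitX_id_sinr.
have := fE (sinr Y x); rewrite comulYX_sinrE projY_sinr (algmap_comulX _ fa) => <-.
have aL := lin_comp (algmapL eLa) (algmapL (dgmap_alg Ha)).
rewrite -[LHS](congr1 (fun h => h x) (conv_unitr CX aL)).
by apply: eq_tmul => u; rewrite ?f23 // fr projY_sinr.
Qed.

(** Likewise from the right counit axiom at y ⊗ 1, by applying eps ⊗ id to
    y1 ⊗ (id ⊗ eps) beta(y2) = y ⊗ 1. *)
Lemma id_counitY_beta y : id_counitY (beta y) = scalar_map X eY y.
Proof.
pose f : B ⊗s B -> X := tmul projX (scalar_map X eB).
have fa : algmap f by apply: tmul_algmap => //; apply/scommute_sym/sBc.
have fE b : f (comulYX DX DY alpha beta b) = projX b.
  exact: (congr1 (fun h => h b) (conv_unitr CB (algmapL pXa))).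
have fl b : f (sinl B b) = projX b by exact: tmul_sinl.
have fr b : f (sinr B b) = scalar_map X eB b by exact: tmul_sinr.
have f23 z : f (leg23 z) = id_counitY z.
  apply: (leg23_eq (g := fun z => id_counitY z)) => // [u|v];
    first by rewrite fl projX_sinr id_counitY_sinl.
  by rewrite fr scalar_map_counit_sinl id_counitY_sinr.
have := fE (sinl X y); rewrite comulYX_sinlE projX_sinl (algmap_comulY _ fa) => <-.
have bL := lin_comp (algmapL eRa) (algmapL (dgmap_alg Hb)).
rewrite -[LHS](congr1 (fun h => h y) (conv_unitl CY bL)).
by apply: eq_tmul => u; rewrite ?f23 // fl projX_sinl.
Qed.

Let Da : algmap (comulYX DX DY alpha beta) :=
  dgmap_alg (comulYX_dgmap dgX dgY HDX HDY Ha Hb Hab).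

(** On y ⊗ 1 the projection turns y1 ⊗ beta(y2) ⊗ 1 into y1 ⊗ (eps ⊗ id) beta(y2),
    which is the coproduct of y by the comodule counit axiom; on 1 ⊗ x it turns
    alpha(x1) and x2 into scalars. *)
Lemma projY_comul b : DY (projY b) = tmap projY projY (comulYX DX DY alpha beta b).
Proof.
pose f : B ⊗s B -> Y ⊗s Y := tmap projY projY.
have fa : algmap f.
  exact: (tmap_algmap pYa pYa (dgmap_homog projY_dgmap) (dgmap_homog projY_dgmap)).
have fl u : f (sinl B u) = sinl Y (projY u).
  by rewrite /f [tmap _ _ _]tmapE ?(pYa.(algmapM).1) //; apply: algmapL.
have fr u : f (sinr B u) = sinr Y (projY u).
  by rewrite /f [tmap _ _ _]tmapE ?(pYa.(algmapM).1) //; apply: algmapL.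
have DYa := dgmap_alg HDY; have la := @sinl_algmap k Y Y; have ra := @sinr_algmap k Y Y.
have f23 z : f (leg23 z) = sinr Y (counitX_id z).
  apply: (leg23_eq (g := fun z => sinr Y (counitX_id z))) => // [|u|v];
    first exact: (algmap_comp ra eLa).
    by rewrite fl projY_sinr counitX_id_sinl !algmap_scalar_map.
  by rewrite fr projY_sinl counitX_id_sinr.
move: b; apply: algmap_stens_eq => [||y|x].
- exact: (algmap_comp DYa pYa).
- exact: (algmap_comp fa Da).
- rewrite projY_sinl comulYX_sinlE -/(f _) (algmap_comulY _ fa).
  rewrite -[LHS]tmul_sinl_sinr; apply: eq_tmul => u; first by rewrite fl projY_sinl.
  by rewrite f23 counitX_id_beta.
- rewrite projY_sinr comulYX_sinrE -/(f _) (algmap_comulX _ fa) algmap_scalar_map //.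
  rewrite -[LHS](congr1 (fun h => h x) (conv_unitl CX (algmapL (sXa (Y ⊗s Y))))).
  apply: eq_tmul => u; first by rewrite f23 counitX_id_alpha algmap_scalar_map.
  by rewrite fr projY_sinr algmap_scalar_map.
Qed.

Lemma projX_comul b : DX (projX b) = tmap projX projX (comulYX DX DY alpha beta b).
Proof.
pose f : B ⊗s B -> X ⊗s X := tmap projX projX.
have fa : algmap f.
  exact: (tmap_algmap pXa pXa (dgmap_homog projX_dgmap) (dgmap_homog projX_dgmap)).
have fl u : f (sinl B u) = sinl X (projX u).
  by rewrite /f [tmap _ _ _]tmapE ?(pXa.(algmapM).1) //; apply: algmapL.
have fr u : f (sinr B u) = sinr X (projX u).
  by rewrite /f [tmap _ _ _]tmapE ?(pXa.(algmapM).1) //; apply: algmapL.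
have DXa := dgmap_alg HDX; have la := @sinl_algmap k X X; have ra := @sinr_algmap k X X.
have f23 z : f (leg23 z) = sinl X (id_counitY z).
  apply: (leg23_eq (g := fun z => sinl X (id_counitY z))) => // [|u|v];
    first exact: (algmap_comp la eRa).
    by rewrite fl projX_sinr id_counitY_sinl.
  by rewrite fr projX_sinl id_counitY_sinr !algmap_scalar_map.
move: b; apply: algmap_stens_eq => [||y|x].
- exact: (algmap_comp DXa pXa).
- exact: (algmap_comp fa Da).
- rewrite projX_sinl comulYX_sinlE -/(f _) (algmap_comulY _ fa) algmap_scalar_map //.
  rewrite -[LHS](congr1 (fun h => h y) (conv_unitl CY (algmapL (sYa (X ⊗s X))))).
  apply: eq_tmul => u; first by rewrite fl projX_sinl algmap_scalar_map.
  by rewrite f23 id_counitY_beta algmap_scalar_map.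
- rewrite projX_sinr comulYX_sinrE -/(f _) (algmap_comulX _ fa).
  rewrite -[LHS]tmul_sinl_sinr; apply: eq_tmul => u; last by rewrite fr projX_sinr.
  by rewrite f23 id_counitY_alpha.
Qed.

Lemma projY_counit b : eY (projY b) = eB b.
Proof.
have eYa : algmap (eY : Y -> k^o) by split.
move: b; apply: (algmap_stens_eq (Z := k^o)) => [||y|x] //.
- exact: (algmap_comp eYa pYa).
- by rewrite projY_sinl sdcc_counit_tens eXM.1 mulr1.
- rewrite projY_sinr sdcc_counit_tens eYM.1 mul1r.
  by rewrite [LHS](linZ (algmapL eYa)) eYM.1 [LHS]mulr1.
Qed.

Lemma projX_counit b : eX (projX b) = eB b.
Proof.
have eXa : algmap (eX : X -> k^o) by split.
move: b; apply: (algmap_stens_eq (Z := k^o)) => [||y|x] //.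
- exact: (algmap_comp eXa pXa).
- rewrite projX_sinl sdcc_counit_tens eXM.1 mulr1.
  by rewrite [LHS](linZ (algmapL eXa)) eXM.1 [LHS]mulr1.
- by rewrite projX_sinr sdcc_counit_tens eYM.1 mul1r.
Qed.

(** Only the outer legs survive: beta(y2) and alpha(x1) are sent to the scalars
    eps(y2) and eps(x1), which the counit axioms of Y and X absorb. *)
Lemma projY_projX_factor b :
  conv (comulYX DX DY alpha beta)
    (fun b => sinl X (projY b)) (fun b => sinr Y (projX b)) b = b.
Proof.
pose f : B ⊗s B -> B := tmul (fun b => sinl X (projY b)) (fun b => sinr Y (projX b)).
have la := algmap_comp (@sinl_algmap k Y X) pYa.
have ra := algmap_comp (@sinr_algmap k Y X) pXa.
have fa : algmap f.
  apply: tmul_algmap => //; apply: (scommute_comp (dgmap_homog projY_dgmap)).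
  apply/scommute_sym/(scommute_comp (dgmap_homog projX_dgmap))/scommute_sym.
  exact: scommute_sinl_sinr.
have fl u : f (sinl B u) = sinl X (projY u) by exact: (tmul_sinl _ la ra).
have fr u : f (sinr B u) = sinr Y (projX u) by exact: (tmul_sinr _ la ra).
have sla := @sinl_algmap k Y X; have sra := @sinr_algmap k Y X.
have f23 z : f (leg23 z) = scalar_map B eY (counitX_id z).
  apply: (leg23_eq (g := fun z => scalar_map B eY (counitX_id z))) => // [|u|v];
    first exact: (algmap_comp (sYa B) eLa).
    rewrite fl projY_sinr counitX_id_sinl (algmap_scalar_map _ _ sla).
    by rewrite (algmap_scalar_map _ _ (sYa B)).
  by rewrite fr projX_sinl counitX_id_sinr algmap_scalar_map.
rewrite /conv -/(f _); move: b; apply: algmap_stens_eq => [||y|x].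
- exact: (algmap_comp fa Da).
- exact: algmap_id.
- rewrite comulYX_sinlE (algmap_comulY _ fa).
  rewrite -[RHS](congr1 (fun h => h y) (conv_unitr CY (algmapL sla))).
  apply: eq_tmul => u; first by rewrite fl projY_sinl.
  by rewrite f23 counitX_id_beta.
- rewrite comulYX_sinrE (algmap_comulX _ fa).
  rewrite -[RHS](congr1 (fun h => h x) (conv_unitl CX (algmapL sra))).
  apply: eq_tmul => u; last by rewrite fr projX_sinr.
  by rewrite f23 counitX_id_alpha (algmap_scalar_map _ _ (sYa B)).
Qed.

Lemma super_antipode (SHX : X -> X) (SHY : Y -> Y) :
    is_antipode DX eX SHX -> parity_preserving SHX ->
    is_antipode DY eY SHY -> parity_preserving SHY ->
  exists S, is_antipode (comulYX DX DY alpha beta) eB S /\ parity_preserving S.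
Proof.
move=> aX oX aY oY.
exists (factor_antipode (comulYX DX DY alpha beta) SHY SHX projY (@sinl k Y X)
  projX (@sinr k Y X)).
have pYL := algmapL pYa; have pXL := algmapL pXa.
split.
  apply: (factor_antipodeP CB aY aX) => //.
  - exact: sinl_algmap.
  - exact: sinr_algmap.
  - exact: projY_comul.
  - exact: projX_comul.
  - exact: projY_counit.
  - exact: projX_counit.
  - exact: projY_projX_factor.
have Dp := homog_parity_preserving (algmapL Da)
  (dgmap_homog (comulYX_dgmap dgX dgY HDX HDY Ha Hb Hab)).
have pYp := homog_parity_preserving pYL (dgmap_homog projY_dgmap).
have pXp := homog_parity_preserving pXL (dgmap_homog projX_dgmap).
have lp := homog_parity_preserving (@sinl_linear k Y X) (@sinl_homog k Y X).
have rp := homog_parity_preserving (@sinr_linear k Y X) (@sinr_homog k Y X).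
have [SXL _ _] := aX; have [SYL _ _] := aY.
move=> b x /Dp; apply: tmul_parity.
- exact: (lin_comp (@sinr_linear k Y X) (lin_comp SXL pXL)).
- exact: (lin_comp (@sinl_linear k Y X) (lin_comp SYL pYL)).
- by move=> c u /pXp /oX /rp.
- by move=> c u /pYp /oY /lp.
Qed.

End SuperAntipode.

Lemma differentiable_dgmap (k : fieldType) (U V W : algType k)
    (XU XV XW : gradedAlgType k) (iotaU : U -> XU) (iotaV : V -> XV) (iotaW : W -> XW)
    (dU : XU -> XU) (dV : XV -> XV) (dW : XW -> XW) gamma gamma_s :
    is_differentiable iotaU iotaV iotaW dU dV dW gamma gamma_s ->
    linear gamma_s -> monoid_morphism gamma_s ->
  dgmap dU (stens_diff dV dW) gamma_s.
Proof. by move=> [gh _ gd] gL gM; split. Qed.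

(** * Strong bicovariance *)

Section Main.
Variables (k : fieldType) (A H : algType k).
Variables (DeltaA : A -> A ⊗ A) (epsA : A -> k) (DeltaH : H -> H ⊗ H) (epsH : H -> k).
Variables (alpha : A -> A ⊗ H) (beta : H -> A ⊗ H).
Variables (OA OH : gradedAlgType k).
Variables (iotaA : A -> OA) (dA : OA -> OA) (iotaH : H -> OH) (dH : OH -> OH).
Variables (DeltaA_s : OA -> OA ⊗s OA) (epsA_s : OA -> k).
Variables (DeltaH_s : OH -> OH ⊗s OH) (epsH_s : OH -> k).
Variables (alpha_s : OA -> OA ⊗s OH) (beta_s : OH -> OA ⊗s OH).
Hypothesis Hdcc : is_double_cross_coproduct DeltaA epsA DeltaH epsH alpha beta.
Hypothesis HA : is_strongly_bicovariant DeltaA epsA iotaA dA DeltaA_s epsA_s.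
Hypothesis HH : is_strongly_bicovariant DeltaH epsH iotaH dH DeltaH_s epsH_s.
Hypothesis Halpha : is_super_right_comodule_algebra DeltaH_s epsH_s alpha_s.
Hypothesis Halpha_d : is_differentiable iotaA iotaA iotaH dA dA dH alpha alpha_s.
Hypothesis Hbeta : is_super_left_comodule_algebra DeltaA_s epsA_s beta_s.
Hypothesis Hbeta_d : is_differentiable iotaH iotaA iotaH dH dA dH beta beta_s.
Hypothesis Hcompat : sdcc_compatible DeltaA_s DeltaH_s alpha_s beta_s.

Let XA := sbicov_exterior HA.
Let XH := sbicov_exterior HH.
Let SA := sbicov_super HA.
Let SH := sbicov_super HH.
Let DAd : dgmap dA (stens_diff dA dA) DeltaA_s := differentiable_dgmap
  (sbicov_diff HA) (coalg_linear (sbialg_coalgebra SA)) (sbialg_comul SA).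
Let DHd : dgmap dH (stens_diff dH dH) DeltaH_s := differentiable_dgmap
  (sbicov_diff HH) (coalg_linear (sbialg_coalgebra SH)) (sbialg_comul SH).
Let ad : dgmap dA (stens_diff dA dH) alpha_s := differentiable_dgmap
  Halpha_d (rcoact_linear (srcoact_coaction Halpha)) (srcoact_mul Halpha).
Let bd : dgmap dH (stens_diff dA dH) beta_s := differentiable_dgmap
  Hbeta_d (lcoact_linear (slcoact_coaction Hbeta)) (slcoact_mul Hbeta).
Let ab : scommute alpha_s beta_s := sdcc_compatC Hcompat.

Local Notation comul_s := (sdcc_comul DeltaA_s DeltaH_s alpha_s beta_s).
Local Notation counit_s := (sdcc_counit epsA_s epsH_s : OH ⊗s OA -> k).
Local Notation iota := (tmap iotaH iotaA : H ⊗ A -> OH ⊗s OA).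

Lemma sdcc_comul_fun : comul_s = comulYX DeltaA_s DeltaH_s alpha_s beta_s.
Proof.
by apply/funext => z; exact: (sdcc_comulE _ _ (ext_dga XA) (ext_dga XH) ad bd ab).
Qed.

Lemma sdcc_comul_dgmap :
  dgmap (stens_diff dH dA) (stens_diff (stens_diff dH dA) (stens_diff dH dA)) comul_s.
Proof.
by rewrite sdcc_comul_fun; apply: (comulYX_dgmap (ext_dga XA) (ext_dga XH)).
Qed.

Lemma sdcc_comul_incl z :
  comul_s (iota z) = tmap iota iota (dcc_comul DeltaA DeltaH alpha beta z).
Proof.
rewrite sdcc_comul_fun; apply: (comulYX_incl XA XH DAd DHd ad bd ab).
- exact: diff_extends (sbicov_diff HA).
- exact: diff_extends (sbicov_diff HH).
- exact: diff_extends Halpha_d.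
- exact: diff_extends Hbeta_d.
Qed.

Lemma sdcc_counit_incl z : counit_s (iota z) = dcc_counit epsA epsH z.
Proof.
have eA := counit_incl (bialg_coalgebra (dcc_bialgA Hdcc)) (sbialg_coalgebra SA)
  (ext_incl_linear XA) (ext_incl_inj XA) (diff_extends (sbicov_diff HA)).
have eH := counit_incl (bialg_coalgebra (dcc_bialgH Hdcc)) (sbialg_coalgebra SH)
  (ext_incl_linear XH) (ext_incl_inj XH) (diff_extends (sbicov_diff HH)).
have eAL : linear (epsA_s : OA -> k^o) := coalg_counit_linear (sbialg_coalgebra SA).
have eHL : linear (epsH_s : OH -> k^o) := coalg_counit_linear (sbialg_coalgebra SH).
rewrite [LHS](tmul_tmap (Z := k^o) z eHL eAL (ext_incl_linear XH) (ext_incl_linear XA)).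
by apply: (eq_tlift (U := k^o)) => h a; rewrite eA eH.
Qed.

Lemma sdcc_is_coalgebra : is_coalgebra comul_s counit_s.
Proof.
have [eL eM] := sdcc_counit_algmap XA SA SH.
apply: (ext_coalgebra (tens_exterior XH XA) (bialg_coalgebra (dcc_bialg Hdcc))) => //.
- exact: sdcc_comul_dgmap.
- exact: sdcc_counit_odd XA XH SA SH.
- exact: sdcc_comul_incl.
- exact: sdcc_counit_incl.
Qed.

Lemma sdcc_is_super_bialgebra : is_super_bialgebra comul_s counit_s.
Proof.
have [Da Dh _] := sdcc_comul_dgmap.
split.
- exact: sdcc_is_coalgebra.
- exact: algmapM Da.
- exact: algmapM (sdcc_counit_algmap XA SA SH).
- exact: homog_parity_preserving (algmapL Da) Dh.
- exact: sdcc_counit_odd XA XH SA SH.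
Qed.

Lemma sdcc_is_differentiable : is_differentiable iota iota iota
  (stens_diff dH dA) (stens_diff dH dA) (stens_diff dH dA)
  (dcc_comul DeltaA DeltaH alpha beta) comul_s.
Proof.
have [_ Dh Dd] := sdcc_comul_dgmap.
by split=> // z; apply: sdcc_comul_incl.
Qed.

Lemma sdcc_antipode : is_super_hopf DeltaA_s epsA_s -> is_super_hopf DeltaH_s epsH_s ->
  exists S, is_antipode comul_s counit_s S /\ parity_preserving S.
Proof.
move=> [_ [SHA [aA pA]]] [_ [SHH [aH pH]]].
have := sdcc_is_coalgebra; rewrite sdcc_comul_fun => CB.
apply: (super_antipode XA XH SA SH DAd DHd ad bd ab _ _ CB aA pA aH pH).
- exact: rcoact_counit (srcoact_coaction Halpha).
- exact: lcoact_counit (slcoact_coaction Hbeta).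
Qed.

End Main.

Theorem theorem3p10 (k : fieldType) (A H : algType k)
  (DeltaA : A -> A ⊗ A) (epsA : A -> k) (DeltaH : H -> H ⊗ H) (epsH : H -> k)
  (alpha : A -> A ⊗ H) (beta : H -> A ⊗ H)
  (OA OH : gradedAlgType k)
  (iotaA : A -> OA) (dA : OA -> OA) (iotaH : H -> OH) (dH : OH -> OH)
  (DeltaA_s : OA -> OA ⊗s OA) (epsA_s : OA -> k)
  (DeltaH_s : OH -> OH ⊗s OH) (epsH_s : OH -> k)
  (alpha_s : OA -> OA ⊗s OH) (beta_s : OH -> OA ⊗s OH)
  (Hdcc : is_double_cross_coproduct DeltaA epsA DeltaH epsH alpha beta)
  (HA : is_strongly_bicovariant DeltaA epsA iotaA dA DeltaA_s epsA_s)
  (HH : is_strongly_bicovariant DeltaH epsH iotaH dH DeltaH_s epsH_s)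
  (Halpha : is_super_right_comodule_algebra DeltaH_s epsH_s alpha_s)
  (Halpha_d : is_differentiable iotaA iotaA iotaH dA dA dH alpha alpha_s)
  (Hbeta : is_super_left_comodule_algebra DeltaA_s epsA_s beta_s)
  (Hbeta_d : is_differentiable iotaH iotaA iotaH dH dA dH beta beta_s)
  (Hcompat : sdcc_compatible DeltaA_s DeltaH_s alpha_s beta_s) :
  is_strongly_bicovariant (A := tensor H A) (X := stensor OH OA)
    (dcc_comul DeltaA DeltaH alpha beta) (dcc_counit epsA epsH)
    (tmap iotaH iotaA) (stens_diff dH dA)
    (sdcc_comul DeltaA_s DeltaH_s alpha_s beta_s) (sdcc_counit epsA_s epsH_s)
  /\
  (is_strongly_bicovariant_hopf DeltaA epsA iotaA dA DeltaA_s epsA_s ->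
   is_strongly_bicovariant_hopf DeltaH epsH iotaH dH DeltaH_s epsH_s ->
   is_strongly_bicovariant_hopf (A := tensor H A) (X := stensor OH OA)
    (dcc_comul DeltaA DeltaH alpha beta) (dcc_counit epsA epsH)
    (tmap iotaH iotaA) (stens_diff dH dA)
    (sdcc_comul DeltaA_s DeltaH_s alpha_s beta_s) (sdcc_counit epsA_s epsH_s)).
Proof.
have XB := tens_exterior (sbicov_exterior HH) (sbicov_exterior HA).
have SB := sdcc_is_super_bialgebra Hdcc HA HH Halpha Halpha_d Hbeta Hbeta_d Hcompat.
have DB := sdcc_is_differentiable HA HH Halpha Halpha_d Hbeta Hbeta_d Hcompat.
split=> [|hA hH]; first by split=> //; apply: dcc_bialg Hdcc.
have [S [aS pS]] := sdcc_antipode Hdcc HA HH Halpha Halpha_d Hbeta Hbeta_d Hcompat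
  (sbicovh_super hA) (sbicovh_super hH).
split=> //; last by split=> //; exists S.
split; first exact: dcc_bialg Hdcc.
have [rho [ra _ rK]] := ext_retraction XB.
exists (fun z => rho (S (tmap iotaH iotaA z))).
apply: (restrict_antipode (ext_incl_linear XB) ra rK _ _ aS).
- exact: (diff_extends DB).
- exact: (sdcc_counit_incl Hdcc HA HH).
Qed.
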